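(* Let $X$ be a complete $\mathrm{CAT}(0)$ cube complex. Then its Izeki-Nayatani invariant satisfies $$\delta(X)\le \frac12 .$$
   Context: A cube complex is a metric polyhedral complex in which each cell is isometric to a Euclidean cube $[0,1]^n$ ($n$ may vary with the cell), and the gluing maps are isometries. It is a $\mathrm{CAT}(0)$ cube complex if it is a $\mathrm{CAT}(0)$ space, and complete if it is complete as a metric space. Neither local compactness (local finiteness) nor finite dimensionality is assumed. Izeki-Nayatani invariant. Let $Y$ be a complete $\mathrm{CAT}(0)$ space with metric $d$, and let $\mathcal{P}(Y)$ be the space of all finitely supported probability measures $\mu$ on $Y$ whose support $\mathrm{supp}(\mu)$ contains at least two points. The barycenter $\mathrm{bar}(\mu)\in Y$ of $\mu$ is the unique point minimizing $y\mapsto \int_Y d(y,p)^2\,\mu(dp)$. For $\mu\in\mathcal{P}(Y)$ define $$\delta(\mu)=\inf_{\phi}\frac{\left\|\int_Y \phi(p)\,\mu(dp)\right\|^2}{\int_Y\|\phi(p)\|^2\,\mu(dp)}\in[0,1],$$ where the infimum is over all maps $\phi:\mathrm{supp}(\mu)\to\mathcal{H}$, with $\mathcal{H}$ a Hilbert space, such that for all $p,q\in\mathrm{supp}(\mu)$ $$\|\phi(p)\|=d(p,\mathrm{bar}(\mu)),\qquad \|\phi(p)-\phi(q)\|\le d(p,q).$$ (Such maps always exist.) Define $\delta(Y)=\sup_{\mu\in\mathcal{P}(Y)}\delta(\mu)\in[0,1]$ (with value $0$ if $\mathcal{P}(Y)$ is empty). *)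

(* Defs.v *)
From HB Require Import structures.
From mathcomp Require Import all_boot all_order all_algebra.
From mathcomp Require Import finmap.
From mathcomp Require Import all_classical all_reals all_analysis.
Set Implicit Arguments.
Unset Strict Implicit.
Unset Printing Implicit Defensive.
Import Order.TTheory GRing.Theory Num.Theory.
Import numFieldNormedType.Exports.
Local Open Scope classical_set_scope.
Local Open Scope ring_scope.

(* The library's norm on row vectors is the sup norm, hence this definition. *)
Definition eucl_dist (R : realType) (n : nat) (u v : 'rV[R]_n) : R :=
  Num.sqrt (\sum_(i < n) (u 0 i - v 0 i) ^+ 2).

Definition cube (R : realType) (n : nat) : set 'rV[R]_n :=
  [set u | forall i, 0 <= u 0 i <= 1].

(* The face of the cube whose relative interior contains [u], for [u] in the
   cube. Every face of the cube is of this form. *)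
Definition supp_face (R : realType) (n : nat) (u : 'rV[R]_n) : set 'rV[R]_n :=
  [set v | cube v /\
     forall i, (u 0 i = 0 -> v 0 i = 0) /\ (u 0 i = 1 -> v 0 i = 1)].

Section Strings.
Variables (R : realType) (X : metricType R).
Variables (cell : Type) (cdim : cell -> nat).
Variable chart : forall l : cell, 'rV[R]_(cdim l) -> X.

(* [cube_string x y r]: some concatenation of straight segments, each contained
   in a single cell, leads from [x] to [y] and has total length [r]. *)
Inductive cube_string : X -> X -> R -> Prop :=
| cube_string_nil x : cube_string x x 0
| cube_string_cons l (u v : 'rV[R]_(cdim l)) y r :
    cube u -> cube v -> cube_string (chart v) y r ->
    cube_string (chart u) y (eucl_dist u v + r).

End Strings.

Unset Implicit Arguments.
(* A metric polyhedral complex (Bridson-Haefliger, I.7.37) all of whose cells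
   are cubes: [X] is the quotient of a disjoint union of cubes, with the
   quotient map given on each cube by [chart l] (the values of [chart l] outside
   the cube are irrelevant), and its distance is the intrinsic one. By
   [chart_inj] each chart is injective on the interior of every face; by
   [chart_glue] faces are glued along isometries. The index type, the
   dimensions and the number of cells at a point are unrestricted; in
   [chart_dist], an infimum over no string at all would be [+oo]. *)
Record cube_complex {R : realType} (X : metricType R) := CubeComplex {
  cell : Type;
  cdim : cell -> nat;
  chart : forall l : cell, 'rV[R]_(cdim l) -> X;
  chart_surj : forall x : X, exists l, exists2 u, cube u & chart l u = x;
  chart_inj : forall l (u v : 'rV[R]_(cdim l)), cube u -> cube v ->
    supp_face u = supp_face v -> chart l u = chart l v -> u = v;
  chart_glue : forall l m (u : 'rV[R]_(cdim l)) (v : 'rV[R]_(cdim m)),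
    cube u -> cube v -> chart l u = chart m v ->
    exists h : 'rV[R]_(cdim l) -> 'rV[R]_(cdim m),
      [/\ h @` supp_face u = supp_face v,
          forall a b, supp_face u a -> supp_face u b ->
            eucl_dist (h a) (h b) = eucl_dist a b
        & forall a, supp_face u a -> chart m (h a) = chart l a];
  chart_dist : forall x y : X,
    (mdist x y)%:E = ereal_inf [set r%:E | r in cube_string chart x y]
}.
Set Implicit Arguments.

Section MetricSpaces.
Variables (R : realType) (X : metricType R).

(* The library's [completeType] would require a designated point of [X]. *)
Definition complete_metric : Prop :=
  forall F : set_system X, ProperFilter F -> cauchy F -> exists x : X, F --> x.

Definition geodesic (x y : X) (c : R -> X) : Prop :=
  [/\ c 0 = x, c (mdist x y) = y &
      forall s t, 0 <= s <= mdist x y -> 0 <= t <= mdist x y ->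
        mdist (c s) (c t) = `|s - t|].

(* [p] lies on the geodesic [c] from [x] to [y], and [p'] is its comparison
   point on the Euclidean segment from [x'] to [y']. *)
Definition comparison_point (x y : X) (c : R -> X) (x' y' : 'rV[R]_2)
    (p : X) (p' : 'rV[R]_2) : Prop :=
  exists2 t : R, 0 <= t <= 1 &
    p = c (t * mdist x y) /\ p' = (1 - t) *: x' + t *: y'.

Definition CAT0 : Prop :=
  (forall x y : X, exists c, geodesic x y c) /\
  (forall (x y z : X) (cxy cyz czx : R -> X) (x' y' z' : 'rV[R]_2),
    geodesic x y cxy -> geodesic y z cyz -> geodesic z x czx ->
    eucl_dist x' y' = mdist x y -> eucl_dist y' z' = mdist y z ->
    eucl_dist z' x' = mdist z x ->
    let triangle_point p p' :=
      [\/ comparison_point x y cxy x' y' p p',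
          comparison_point y z cyz y' z' p p'
        | comparison_point z x czx z' x' p p'] in
    forall p q p' q', triangle_point p p' -> triangle_point q q' ->
      mdist p q <= eucl_dist p' q').

(* A finitely supported measure is given by its point masses; integration
   against it is summation over [finsupp mu]. *)
Definition finsupp_proba (mu : {fsfun X -> R with 0}) : Prop :=
  [/\ forall x, 0 <= mu x,
      \sum_(x <- finsupp mu) mu x = 1 &
      (1 < #|` finsupp mu|)%N].

Definition is_barycenter (mu : {fsfun X -> R with 0}) (b : X) : Prop :=
  forall y, y <> b ->
    \sum_(p <- finsupp mu) mu p * mdist b p ^+ 2 <
    \sum_(p <- finsupp mu) mu p * mdist y p ^+ 2.

(* The Hilbert norm of [H] is the one coming from the inner product [ip]. Only
   the values of [phi] on the support of [mu] matter. *)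
Definition IN_map (mu : {fsfun X -> R with 0}) (b : X)
    (H : completeNormedModType R) (ip : {dot H for idfun}) (phi : X -> H) :
    Prop :=
  [/\ forall v : H, `|v| ^+ 2 = ip v v,
      forall p, p \in finsupp mu -> `|phi p| = mdist p b &
      forall p q, p \in finsupp mu -> q \in finsupp mu ->
        `|phi p - phi q| <= mdist p q].

Definition IN_quotient (mu : {fsfun X -> R with 0})
    (H : completeNormedModType R) (phi : X -> H) : R :=
  `| \sum_(p <- finsupp mu) mu p *: phi p | ^+ 2 /
  \sum_(p <- finsupp mu) mu p * `|phi p| ^+ 2.

(* The barycenter [b] is unique if it exists. The infimum is taken in the
   extended reals, so it would be [+oo] if there were no barycenter or no map. *)
Definition IN_delta (mu : {fsfun X -> R with 0}) : \bar R :=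
  ereal_inf [set e : \bar R |
    exists (b : X) (H : completeNormedModType R) (ip : {dot H for idfun})
           (phi : X -> H),
      [/\ is_barycenter mu b, IN_map mu b ip phi &
          e = (IN_quotient mu phi)%:E]].

Definition IN_invariant : \bar R :=
  if `[< exists mu, finsupp_proba mu >] then
    ereal_sup [set IN_delta mu | mu in finsupp_proba]
  else 0%E.

End MetricSpaces.

Arguments complete_metric {R} X.
Arguments CAT0 {R} X.
Arguments IN_invariant {R} X.

(* Main.v *)
Require Import Defs.
From HB Require Import structures.
From mathcomp Require Import all_boot all_order all_algebra.
From mathcomp Require Import finmap.
From mathcomp Require Import all_classical all_reals all_analysis.
From mathcomp Require Import ring lra.

(* Let b be the barycenter of mu. Near b, a point x lies in a cell with b, and
   its displacement from b splits into components along the edge directions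
   leaving b. Identifying each direction with the point at a fixed small distance
   along it makes these components well defined and gives a map iota from a
   neighbourhood of b to a Euclidean space such that |iota x| = d(b, x). It is
   isometric on orthants of cells, hence 1-Lipschitz since the distance is
   intrinsic. So phi p, the rescaled image of the initial part of the geodesic
   from b to p, is admissible for delta(mu).
   Conversely, cells being injected (a CAT(0) property), convexity of the squared
   distance yields
     d(x, y)^2 <= (|x| + |y|)^2 - 4 <iota x, iota y>,
   that is, 2 cos(iota x, iota y) <= 1 + cos(angle at b). Moving b towards p does
   not decrease the mean squared distance to mu; to first order this says
     0 <= sum_q mu_q (d(b,p) d(b,q) - 2 <phi p, phi q>),
   and averaging over p gives
     2 |sum mu phi|^2 <= (sum mu_p d(b,p))^2 <= sum mu_p d(b,p)^2. *)

Set Implicit Arguments.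
Unset Strict Implicit.
Unset Printing Implicit Defensive.
Import Order.TTheory GRing.Theory Num.Theory.
Import numFieldNormedType.Exports.
Local Open Scope classical_set_scope.
Local Open Scope ring_scope.

(** * Euclidean spaces *)

(** The cone inequality is sharp already on a line: opposite directions at b become orthogonal under
    iota, and 2 cos = 0 = 1 + cos pi. The obstacle is the absence of local finiteness: infinitely
    many cells of unbounded dimension may meet at b, so compactness yields no conical neighbourhood.
    Instead one margin e, a lower bound for the distance from b to the facets avoiding it, serves
    all cells at b because gluing isometries preserve it, and paths shorter than e are followed from
    cell to cell. Only the directions of finitely many geodesics enter, hence a finite-dimensional
    target; scales depending on the dimension of a cell are harmless for the same reason. The cone
    inequality holds only near b, so the first variation towards p compares the point at parameter t
    on [b, p] with the point at a fixed parameter r on [b, q], and t alone tends to 0. *)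

Section EuclideanNorm.
Variable R : realType.

Definition dotp n (u v : 'rV[R]_n) : R := \sum_i u 0 i * v 0 i.

Definition enorm n (u : 'rV[R]_n) : R := Num.sqrt (dotp u u).

Section Dimension.
Variable n : nat.
Implicit Types u v w : 'rV[R]_n.

Lemma dotpC u v : dotp u v = dotp v u.
Proof. by apply: eq_bigr => i _; rewrite mulrC. Qed.

Lemma dotpDl u v w : dotp (u + v) w = dotp u w + dotp v w.
Proof. by rewrite -big_split /=; apply: eq_bigr => i _; rewrite mxE mulrDl. Qed.

Lemma dotpZl a u v : dotp (a *: u) v = a * dotp u v.
Proof. by rewrite big_distrr /=; apply: eq_bigr => i _; rewrite mxE mulrA. Qed.

Lemma dotpNl u v : dotp (- u) v = - dotp u v.
Proof. by rewrite -scaleN1r dotpZl mulN1r. Qed.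

Lemma dotpDr u v w : dotp u (v + w) = dotp u v + dotp u w.
Proof. by rewrite dotpC dotpDl !(dotpC _ u). Qed.

Lemma dotpZr a u v : dotp u (a *: v) = a * dotp u v.
Proof. by rewrite dotpC dotpZl dotpC. Qed.

Lemma dotpNr u v : dotp u (- v) = - dotp u v.
Proof. by rewrite dotpC dotpNl dotpC. Qed.

Lemma dotp_ge0 u : 0 <= dotp u u.
Proof. by apply: sumr_ge0 => i _; rewrite -expr2 sqr_ge0. Qed.

Lemma dotp_eq0 u : (dotp u u == 0) = (u == 0).
Proof.
apply/idP/eqP => [|->]; last by rewrite /dotp big1// => i _; rewrite mxE mul0r.
rewrite psumr_eq0 => [/allP h|i _]; last by rewrite -expr2 sqr_ge0.
apply/rowP => i; have := h i; rewrite mem_index_enum mxE -expr2 sqrf_eq0.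
by move/(_ isT)/eqP.
Qed.

Lemma enorm_ge0 u : 0 <= enorm u. Proof. exact: sqrtr_ge0. Qed.

Lemma enorm_sqr u : enorm u ^+ 2 = dotp u u.
Proof. by rewrite sqr_sqrtr ?dotp_ge0. Qed.

Lemma enorm_eq0 u : (enorm u == 0) = (u == 0).
Proof. by rewrite -dotp_eq0 -enorm_sqr sqrf_eq0. Qed.

Lemma enorm0 : enorm (0 : 'rV[R]_n) = 0.
Proof. by apply/eqP; rewrite enorm_eq0. Qed.

Lemma enormZ a u : enorm (a *: u) = `|a| * enorm u.
Proof.
by rewrite /enorm dotpZl dotpZr mulrA -expr2 sqrtrM ?sqr_ge0// sqrtr_sqr.
Qed.

Lemma enormN u : enorm (- u) = enorm u.
Proof. by rewrite -scaleN1r enormZ normrN1 mul1r. Qed.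

Lemma enormB u v : enorm (u - v) = enorm (v - u).
Proof. by rewrite -enormN opprB. Qed.

Lemma dotp_le_enorm u v : dotp u v <= enorm u * enorm v.
Proof.
have [->|u0] := eqVneq u 0.
  by rewrite enorm0 mul0r -(scale0r 0) dotpZl mul0r.
have nu : 0 < enorm u by rewrite lt_neqAle enorm_ge0 eq_sym enorm_eq0 u0.
have := dotp_ge0 ((dotp u v / enorm u ^+ 2) *: u - v).
rewrite !(dotpDl, dotpDr, dotpNl, dotpNr, dotpZl, dotpZr) (dotpC v u).
rewrite -!enorm_sqr => H.
have {}H : 0 <= enorm v ^+ 2 - dotp u v ^+ 2 / enorm u ^+ 2.
  suff <- : dotp u v / enorm u ^+ 2 * (dotp u v / enorm u ^+ 2 * enorm u ^+ 2) -
    dotp u v / enorm u ^+ 2 * dotp u v - (dotp u v / enorm u ^+ 2 * dotp u v -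
    enorm v ^+ 2) = enorm v ^+ 2 - dotp u v ^+ 2 / enorm u ^+ 2.
    by rewrite (le_trans H)//; lra.
  by field; rewrite gt_eqF.
rewrite (le_trans (ler_norm _))// -ler_sqr ?nnegrE ?mulr_ge0 ?enorm_ge0//.
rewrite real_normK ?num_real// exprMn mulrC -ler_pdivrMr ?exprn_gt0//.
by rewrite -subr_ge0.
Qed.

Lemma enormD u v : enorm (u + v) <= enorm u + enorm v.
Proof.
rewrite -ler_sqr ?nnegrE ?addr_ge0 ?enorm_ge0//.
rewrite sqrrD !enorm_sqr dotpDl !dotpDr (dotpC v u).
have := dotp_le_enorm u v; lra.
Qed.

Lemma eucl_distE u v : eucl_dist u v = enorm (u - v).
Proof.
congr Num.sqrt; apply: eq_bigr => i _.
by rewrite !mxE expr2.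
Qed.

Lemma ler_coord_enorm u i : `|u 0 i| <= enorm u.
Proof.
rewrite -sqrtr_sqr ler_sqrt ?dotp_ge0// /dotp (bigD1 i)//= expr2 lerDl.
by apply: sumr_ge0 => j _; rewrite -expr2 sqr_ge0.
Qed.

Lemma dotp_delta u i : dotp u (delta_mx 0 i) = u 0 i.
Proof.
rewrite /dotp (bigD1 i)//= mxE !eqxx mulr1 big1 ?addr0// => j ji.
by rewrite mxE (negbTE ji) andbF mulr0.
Qed.

Lemma dotpBB u v : dotp (u - v) (u - v) = dotp u u - 2 * dotp u v + dotp v v.
Proof. rewrite dotpDl !dotpDr !dotpNl !dotpNr (dotpC v u); ring. Qed.

(** Polarization for differences: an inner product is expressed by four distances, so a
    distance-preserving map preserves it before anything is known about its linearity. *)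
Lemma dotp_polar u v p q : 2 * dotp (u - p) (v - q) =
  enorm (u - q) ^+ 2 + enorm (p - v) ^+ 2 - enorm (u - v) ^+ 2 - enorm (p - q) ^+ 2.
Proof.
rewrite !enorm_sqr !dotpBB !(dotpDl, dotpDr, dotpNl, dotpNr); ring.
Qed.

End Dimension.
End EuclideanNorm.

(* 'rV[R]_n carries the sup norm, so the Euclidean space needs its own type. *)
Definition euclidean (R : realType) (n : nat) := 'rV[R]_n.

Section EuclideanSpace.
Variables (R : realType) (n : nat).

HB.instance Definition _ := GRing.Lmodule.copy (euclidean R n) 'rV[R]_n.

Let enormZ' (a : R) (u : euclidean R n) : enorm (a *: u) = `|a| * enorm u.
Proof. exact: enormZ. Qed.

Let enorm0_eq0 (u : euclidean R n) : enorm u = 0 -> u = 0.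
Proof. by move/eqP; rewrite enorm_eq0 => /eqP. Qed.

HB.instance Definition _ := Lmodule_isNormed.Build R (euclidean R n)
  (@enormD R n) enormZ' enorm0_eq0.

End EuclideanSpace.

(** * Euclidean space as a Hilbert space *)

Section EuclideanComplete.
Variables (R : realType) (n : nat).
Local Notation E := (euclidean R n).

Lemma euclidean_normE (u : E) : `|u| = enorm u.
Proof. by []. Qed.

Lemma enorm_le_sum (u : 'rV[R]_n) : enorm u <= \sum_i `|u 0 i|.
Proof.
rewrite -ler_sqr ?nnegrE ?enorm_ge0 ?sumr_ge0// enorm_sqr expr2 /dotp.
rewrite big_distrl /=; apply: ler_sum => i _.
rewrite (le_trans (ler_norm _))// normrM ler_wpM2l//.
by rewrite (bigD1 i)//= lerDl sumr_ge0.
Qed.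

Lemma euclidean_complete (F : set_system E) : ProperFilter F -> cauchy F -> cvg F.
Proof.
move=> PF /cauchyP cF.
have cF' i : cvg ((fun u : E => u 0 i : R^o) @ F).
  apply: cauchy_cvg; apply/cauchyP => e e0.
  have [u Fu] := cF e e0; exists (u 0 i).
  suff : F [set v : E | ball (u 0 i : R^o) e (v 0 i)] by [].
  apply: filterS Fu => v; rewrite -!ball_normE /=.
  apply: le_lt_trans; have := @ler_coord_enorm R n (u - v) i.
  by rewrite !mxE.
pose l : E := \row_i lim ((fun u : E => u 0 i : R^o) @ F).
apply/cvg_ex; exists l.
apply/(@cvgrPdist_lt _ E) => e e0.
(* [n.+1] instead of [n] covers dimension 0 and makes the sum of the [n] bounds strictly smaller
   than [e]. *)
have H : F [set u : E | forall i : 'I_n, `|l 0 i - u 0 i| < e / n.+1%:R].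
  apply: filter_forall => i; rewrite mxE.
  by have /cvgrPdist_lt := cF' i; apply; rewrite divr_gt0.
apply: filterS H => u Hu; rewrite euclidean_normE.
rewrite (le_lt_trans (enorm_le_sum _))//.
rewrite (@le_lt_trans _ _ (\sum_(i < n) e / n.+1%:R))//.
  by apply: ler_sum => i _; have := Hu i; rewrite !mxE => /ltW.
rewrite sumr_const card_ord -[ltLHS]mulr_natl mulrCA gtr_pMr// ltr_pdivrMr//.
by rewrite mul1r ltr_nat.
Qed.

HB.instance Definition _ := Uniform_isComplete.Build E euclidean_complete.

Definition edot (u v : E) : R := dotp u v.

Let edot_bilinear : bilinear_for ( *%R : R -> R -> R) (idfun \; *%R) edot.
Proof.
split => [v a u w|u a v w]; rewrite /edot/=.
  by rewrite dotpDl dotpZl.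
by rewrite dotpDr dotpZr.
Qed.

HB.instance Definition _ := bilinear_isBilinear.Build R E E R *%R (idfun \; *%R)
  edot edot_bilinear.

Let edot_sym u v : edot u v = (-1) ^+ false * edot v u.
Proof. by rewrite expr0 mul1r /edot dotpC. Qed.

HB.instance Definition _ := isHermitianSesquilinear.Build R E false idfun
  edot edot_sym.

Let edot_gt0 (u : E) : u != 0 -> 0 < edot u u.
Proof.
move=> u0; rewrite lt_neqAle dotp_ge0 andbT eq_sym.
by rewrite (@dotp_eq0 R n).
Qed.

HB.instance Definition _ := isDotProduct.Build R E edot edot_gt0.

End EuclideanComplete.

(** * CAT(0) geometry *)

Section CAT0Geometry.
Variables (R : realType) (X : metricType R).
Hypothesis cat0X : CAT0 X.
Implicit Types x y z m : X.

(** With [a] laid along the first axis, [al] is the abscissa of the third vertex given by the law of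
    cosines; the triangle inequalities give [|al| <= c], so the height [be] is real. *)
Lemma comparison_triangle (a b c : R) :
  0 <= a -> 0 <= b -> 0 <= c -> a <= b + c -> b <= a + c -> c <= a + b ->
  exists x' y' z' : 'rV[R]_2, [/\ eucl_dist x' y' = a,
    eucl_dist y' z' = b & eucl_dist z' x' = c].
Proof.
move=> a0 b0 c0 abc bac cab.
have [al [be [h1 h2]]] : exists al be : R,
    al ^+ 2 + be ^+ 2 = c ^+ 2 /\ (a - al) ^+ 2 + be ^+ 2 = b ^+ 2.
  have [aE|an0] := eqVneq a 0.
    have bc : b = c by lra.
    by exists c, 0; rewrite aE bc; split; ring.
  have a_gt0 : 0 < a by rewrite lt_neqAle eq_sym an0.
  pose al := (a ^+ 2 + c ^+ 2 - b ^+ 2) / (2 * a).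
  have alE : 2 * a * al = a ^+ 2 + c ^+ 2 - b ^+ 2 by rewrite /al; field.
  have hc : 0 <= c ^+ 2 - al ^+ 2.
    rewrite subr_ge0 -[leLHS]real_normK ?num_real// ler_sqr ?nnegrE//.
    by rewrite ler_norml; apply/andP; split;
      rewrite -(ler_pM2l (_ : 0 < 2 * a)) ?alE ?mulr_gt0//; nra.
  exists al, (Num.sqrt (c ^+ 2 - al ^+ 2)); rewrite sqr_sqrtr//; split; first ring.
  have -> : (a - al) ^+ 2 = a ^+ 2 - 2 * a * al + al ^+ 2 by ring.
  by rewrite alE; ring.
pose pt u v : 'rV[R]_2 := \row_i if i == 0 then u else v.
have ptE u v u' v' : eucl_dist (pt u v) (pt u' v') =
    Num.sqrt ((u - u') ^+ 2 + (v - v') ^+ 2).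
  by rewrite /eucl_dist big_ord_recl big_ord1 !mxE.
exists (pt 0 0), (pt a 0), (pt al be); rewrite !ptE; split.
- by rewrite subrr expr0n addr0 sub0r sqrrN sqrtr_sqr ger0_norm.
- by rewrite sub0r sqrrN h2 sqrtr_sqr ger0_norm.
- by rewrite !subr0 h1 sqrtr_sqr ger0_norm.
Qed.

Lemma mdist_triangles x y z :
  [/\ mdist x y <= mdist y z + mdist z x, mdist y z <= mdist x y + mdist z x
    & mdist z x <= mdist x y + mdist y z].
Proof.
split.
- by rewrite addrC (metric_sym z x) (metric_sym y z) metric_triangle.
- by rewrite (metric_sym x y) (metric_sym z x) metric_triangle.
- by rewrite addrC (metric_sym x y) (metric_sym y z) metric_triangle.
Qed.

Lemma geodesic_rev x y c : geodesic x y c ->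
  geodesic y x (fun t => c (mdist x y - t)).
Proof.
move=> [c0 c1 cd]; split; rewrite ?subr0//.
  by rewrite (metric_sym y x) subrr.
move=> s t; rewrite (metric_sym y x) => hs ht.
rewrite cd; [|lra|lra]; rewrite -normrN; congr `|_|; ring.
Qed.

(** The triangle is compared at its vertex [z] and a point of the opposite side; in the plane the
    right-hand side is Stewart's formula for that distance. *)
Lemma geodesic_comparison x y z (c : R -> X) (t : R) :
  geodesic x y c -> 0 <= t <= 1 ->
  mdist z (c (t * mdist x y)) ^+ 2 <= (1 - t) * mdist z x ^+ 2 +
    t * mdist z y ^+ 2 - t * (1 - t) * mdist x y ^+ 2.
Proof.
move=> gc t01.
have [/(_ y z)[cyz gyz] h] := cat0X; have [/(_ z x)[czx gzx] _] := cat0X.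
have [t1 t2 t3] := mdist_triangles x y z.
have [x' [y' [z' [xy' yz' zx']]]] :=
  comparison_triangle (mdist_ge0 _ _) (mdist_ge0 _ _) (mdist_ge0 _ _) t1 t2 t3.
have /= := h _ _ _ _ _ _ _ _ _ gc gyz gzx xy' yz' zx'
  z (c (t * mdist x y)) z' ((1 - t) *: x' + t *: y').
move=> /(_ _ _)/wrap[].
  apply: Or33; exists 0; first lra.
  by case: gzx => c0 _ _; rewrite mul0r c0 subr0 scale1r scale0r addr0.
  by apply: Or31; exists t.
move: xy' yz' zx'; rewrite !eucl_distE => xy' yz' zx' H.
have := H; rewrite -ler_sqr ?nnegrE ?mdist_ge0 ?enorm_ge0// => /le_trans; apply.
rewrite (metric_sym z y) -xy' -yz' -zx' !enorm_sqr.
rewrite !(dotpDl, dotpDr, dotpNl, dotpNr, dotpZl, dotpZr).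
rewrite (dotpC z' x') (dotpC z' y') (dotpC y' x').
rewrite le_eqVlt; apply/orP; left; apply/eqP; ring.
Qed.

(** Stewart's bound for [z := m]: the two distance bounds make its right-hand side at most [t (1 -
    t) (t + (1 - t) - 1) d(x, y)^2 = 0]. *)
Lemma geodesic_unique x y m c t : geodesic x y c -> 0 <= t <= 1 ->
  mdist x m <= t * mdist x y -> mdist m y <= (1 - t) * mdist x y ->
  m = c (t * mdist x y).
Proof.
move=> gc t01 xm my; apply: mdist_positivity; apply/eqP.
rewrite -sqrf_eq0 eq_le sqr_ge0 andbT.
apply: (le_trans (geodesic_comparison m gc t01)).
have h1 : mdist m x ^+ 2 <= (t * mdist x y) ^+ 2.
  by rewrite (metric_sym m x) ler_sqr ?nnegrE ?mulr_ge0 ?mdist_ge0//; lra.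
have h2 : mdist m y ^+ 2 <= ((1 - t) * mdist x y) ^+ 2.
  by rewrite ler_sqr ?nnegrE ?mulr_ge0 ?mdist_ge0//; lra.
have h1' : (1 - t) * mdist m x ^+ 2 <= (1 - t) * (t * mdist x y) ^+ 2.
  by rewrite ler_wpM2l//; lra.
have h2' : t * mdist m y ^+ 2 <= t * ((1 - t) * mdist x y) ^+ 2.
  by rewrite ler_wpM2l//; lra.
nra.
Qed.

Lemma between_unique x y m m' t : 0 <= t <= 1 ->
  mdist x m <= t * mdist x y -> mdist m y <= (1 - t) * mdist x y ->
  mdist x m' <= t * mdist x y -> mdist m' y <= (1 - t) * mdist x y -> m = m'.
Proof.
move=> t01 xm my xm' my'; have [/(_ x y)[c gc] _] := cat0X.
by rewrite (geodesic_unique gc t01 xm my) (geodesic_unique gc t01 xm' my').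
Qed.

(** The intermediate point is given by upper bounds on its distances to the ends, so that chart
    estimates can supply it without exhibiting a geodesic. *)
Lemma CN_inequality x y m z t : 0 <= t <= 1 ->
  mdist x m <= t * mdist x y -> mdist m y <= (1 - t) * mdist x y ->
  mdist z m ^+ 2 <= (1 - t) * mdist z x ^+ 2 + t * mdist z y ^+ 2
    - t * (1 - t) * mdist x y ^+ 2.
Proof.
move=> t01 xm my; have [/(_ x y)[c gc] _] := cat0X.
by rewrite (geodesic_unique gc t01 xm my); exact: geodesic_comparison.
Qed.

Lemma geodesic_contraction x y z cy cz t : geodesic x y cy -> geodesic x z cz ->
  0 <= t <= 1 -> mdist (cy (t * mdist x y)) (cz (t * mdist x z)) <= t * mdist y z.
Proof.
move=> gy gz t01; have [/(_ y z)[cyz gyz] h] := cat0X.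
have [t1 t2 t3] := mdist_triangles x y z.
have [x' [y' [z' [xy' yz' zx']]]] :=
  comparison_triangle (mdist_ge0 _ _) (mdist_ge0 _ _) (mdist_ge0 _ _) t1 t2 t3.
(* Triangles in [CAT0] are traversed cyclically, so the side from [x] to [z] is entered backwards,
   with parameter [1 - t]. *)
have gzr := geodesic_rev gz.
have /= := h _ _ _ _ _ _ _ _ _ gy gyz gzr xy' yz' zx'
  (cy (t * mdist x y)) (cz (t * mdist x z))
  ((1 - t) *: x' + t *: y') ((1 - (1 - t)) *: z' + (1 - t) *: x').
move=> /(_ _ _)/wrap[].
- by apply: Or31; exists t.
- apply: Or33; exists (1 - t); first lra.
  by split => //; rewrite (metric_sym z x); congr cz; ring.
have -> : eucl_dist ((1 - t) *: x' + t *: y') ((1 - (1 - t)) *: z' + (1 - t) *: x')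
    = t * eucl_dist y' z'.
  rewrite !eucl_distE -[t in RHS]ger0_norm; last lra.
  rewrite -enormZ; congr enorm; apply/rowP => i; rewrite !mxE; ring.
by rewrite yz'.
Qed.

(** * Existence of barycenters *)

Section Barycenter.
Variable mu : {fsfun X -> R with 0}.
Hypothesis muP : finsupp_proba mu.
Hypothesis complX : complete_metric X.

Let F y := \sum_(p <- finsupp mu) mu p * mdist y p ^+ 2.

Lemma exists_midpoint x y : exists m, mdist x m <= 2^-1 * mdist x y /\
  mdist m y <= (1 - 2^-1) * mdist x y.
Proof.
have [/(_ x y)[c [c0 c1 cd]] _] := cat0X; have d0 := mdist_ge0 x y.
exists (c (2^-1 * mdist x y)); split.
  rewrite -{1}c0 cd; [|lra|lra].
  by rewrite sub0r normrN ger0_norm//; lra.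
rewrite -{2}c1 cd; [|lra|lra].
by rewrite -normrN ger0_norm; lra.
Qed.

(** Averaging the CN inequality over [mu] makes the mean squared distance uniformly convex; this
    gives both the convergence of minimizing sequences and the strict minimality of their limit. *)
Lemma variance_midpoint x y : exists m,
  F m <= 2^-1 * F x + 2^-1 * F y - 4^-1 * mdist x y ^+ 2.
Proof.
have [m [xm my]] := exists_midpoint x y; exists m.
have [mu0 mu1 _] := muP.
rewrite -[4^-1 * _]mul1r -[X in X * (4^-1 * _)]mu1 /F !mulr_sumr mulr_suml -big_split/= -sumrB.
apply: ler_sum => p _.
rewrite [leRHS](_ : _ = mu p * (2^-1 * mdist x p ^+ 2 + 2^-1 * mdist y p ^+ 2 -
  4^-1 * mdist x y ^+ 2)); last by ring.
rewrite ler_wpM2l// (metric_sym m p) (metric_sym x p) (metric_sym y p).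
apply: le_trans (CN_inequality p _ xm my) _; first lra.
by rewrite le_eqVlt; apply/orP; left; apply/eqP; field.
Qed.

Lemma exists_barycenter : exists b, is_barycenter mu b.
Proof.
have [mu0 mu1 mu2] := muP.
have F0 y : 0 <= F y by apply: sumr_ge0 => p _; rewrite mulr_ge0 ?sqr_ge0.
have [x0 _] : exists x0 : X, True.
  case: (fset_0Vmem (finsupp mu)) => [E|[x _]]; last by exists x.
  by move: mu2; rewrite E cardfs0.
pose I := inf (range F).
have hI : has_inf (range F).
  by split; [exists (F x0), x0|exists 0 => _ [y _ <-]].
have IF y : I <= F y by apply: ge_inf; [exact: hI.2|exists y].
have /choice[u uP] : forall n : nat, exists y, F y < I + n.+1%:R^-1.
  move=> n; have [|_ [y _ <-] ?] := inf_adherent (_ : 0 < n.+1%:R^-1) hI.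
    by rewrite invr_gt0.
  by exists y.
(* Both values are within [n.+1%:R^-1] of the infimum [I] and the midpoint value is not below
   [I]. *)
have du n k l : (n <= k)%N -> (n <= l)%N -> mdist (u k) (u l) ^+ 2 < 4 * n.+1%:R^-1.
  move=> nk nl; have [m Fm] := variance_midpoint (u k) (u l).
  have := IF m; have := uP k; have := uP l.
  have : k.+1%:R^-1 <= n.+1%:R^-1 :> R by rewrite lef_pV2 ?posrE// ler_nat.
  have : l.+1%:R^-1 <= n.+1%:R^-1 :> R by rewrite lef_pV2 ?posrE// ler_nat.
  move: Fm; move: (k.+1%:R^-1 : R) (l.+1%:R^-1 : R) (n.+1%:R^-1 : R) => a b c.
  by move: (F m) (F (u k)) (F (u l)) (mdist _ _ ^+ 2) => A B C D; lra.
have small (e : R) : 0 < e -> exists n : nat, n.+1%:R^-1 < e.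
  by move=> /ltr_add_invr[n]; rewrite add0r; exists n.
have cu : cauchy (u @ \oo).
  apply/cauchyP => e e0; have [n ne] := small (e ^+ 2 / 4) ltac:(by rewrite divr_gt0 ?exprn_gt0).
  exists (u n); exists n => // k /= nk.
  rewrite ballEmdist /= -ltr_sqr ?nnegrE ?mdist_ge0 ?ltW//.
  by apply: lt_trans (du n n k _ _) _ => //; rewrite mulrC -ltr_pdivlMr.
have [b ub] := complX (fmap_proper_filter u _) cu.
have Fb : F b <= I.
  (* Semicontinuity by hand: [d(b, y) < e] gives [d(b, p)^2 <= d(y, p)^2 + 2 e d(b, p)], and [C] is
     the mean of [d(b, p)]. *)
  pose C := \sum_(p <- finsupp mu) mu p * mdist b p.
  have C0 : 0 <= C by apply: sumr_ge0 => p _; rewrite mulr_ge0 ?mdist_ge0.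
  suff H e : 0 < e -> F b <= I + e + 2 * e * C.
    apply/ler_addgt0Pr => e e0.
    have C1 : 0 < 1 + 2 * C by lra.
    have := H (e / (1 + 2 * C)) (divr_gt0 e0 C1).
    suff -> : I + e / (1 + 2 * C) + 2 * (e / (1 + 2 * C)) * C = I + e by [].
    by field; rewrite gt_eqF.
  move=> e0; have [n ne] := small e e0.
  have [N _ /(_ (maxn n N))] := ub _ (nbhsx_ballx b e e0).
  move=> /(_ (leq_maxr _ _)) /=; set y := u _; rewrite ballEmdist /= => by_e.
  have Fy : F y < I + e.
    apply: lt_trans (uP _) _; rewrite ltrD2l (le_lt_trans _ ne)//.
    by rewrite lef_pV2 ?posrE// ler_nat ltnS leq_maxl.
  apply: (@le_trans _ _ (F y + 2 * e * C)); last by rewrite lerD2r ltW.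
  rewrite mulr_sumr /F -big_split; apply: ler_sum => p _ /=.
  rewrite [leRHS](_ : _ = mu p * (mdist y p ^+ 2 + 2 * e * mdist b p)); last by ring.
  rewrite ler_wpM2l//.
  have := metric_triangle b y p; have := mdist_ge0 b p; have := mdist_ge0 y p.
  move: by_e; move: (mdist b p) (mdist y p) (mdist b y) => B Y D De Y0 B0 BDY.
  by have [Be|eB] := leP B e; nra.
exists b => y /eqP yb; rewrite -/(F b) -/(F y).
have d0 : 0 < mdist b y by rewrite mdist_gt0 eq_sym.
rewrite ltNge; apply/negP => Fyb.
have [m Fm] := variance_midpoint b y; have := IF m.
have : 0 < mdist b y ^+ 2 by rewrite exprn_gt0.
lra.
Qed.

End Barycenter.
End CAT0Geometry.

(** * Faces of cubes and their isometries *)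

Section Cubes.
Variable R : realType.

(** A distance kept from all facets that avoid [u]; within it the cube looks like its tangent cone
    at [u]. For [e <= 2^-1] it does not depend on the cell in which a point is seen
    ([glue_margin]). *)
Definition margin n (e : R) (u : 'rV[R]_n) : Prop :=
  forall i, (u 0 i != 0 -> e <= u 0 i) /\ (u 0 i != 1 -> u 0 i <= 1 - e).

Definition set_coord n (u : 'rV[R]_n) (i : 'I_n) (c : R) : 'rV[R]_n :=
  \row_j if j == i then c else u 0 j.

Section OneCube.
Variable n : nat.
Implicit Types u v a b : 'rV[R]_n.

Lemma exists_margin u : cube u -> exists2 e, 0 < e <= 2^-1 & margin e u.
Proof.
move=> cu.
pose f i : R := if u 0 i == 0 then 2^-1 else if u 0 i == 1 then 2^-1
  else Num.min 2^-1 (Num.min (u 0 i) (1 - u 0 i)).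
have f0 i : 0 < f i.
  rewrite /f; case: (eqVneq (u 0 i) 0) => [_|h0]; first by rewrite invr_gt0.
  case: (eqVneq (u 0 i) 1) => [_|h1]; first by rewrite invr_gt0.
  have /andP[h2 h3] := cu i.
  have h4 : 0 < u 0 i by rewrite lt_neqAle eq_sym h0.
  have h5 : u 0 i < 1 by rewrite lt_neqAle h1.
  by rewrite !lt_min h4 subr_gt0 h5 invr_gt0 ltr0n.
pose e : R := \big[Num.min/2^-1]_i f i.
have ef i : e <= f i by rewrite /e (bigD1 i)//= ge_min lexx.
exists e.
  apply/andP; split; last exact: bigmin_le_id.
  by apply: lt_bigmin => //; rewrite invr_gt0.
move=> i; have := ef i; have /andP[h2 h3] := cu i; rewrite /f.
have [->|h0] := eqVneq (u 0 i) 0; first by move=> h; split => //; lra.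
have [->|h1] := eqVneq (u 0 i) 1; first by move=> h; split => //; lra.
by rewrite !le_min => /and3P[h4 h5 h6]; split => _; lra.
Qed.

Lemma supp_face_refl u : cube u -> supp_face u u.
Proof. by move=> cu; split => // i; split. Qed.

Lemma supp_face_segment u a b t : supp_face u a -> supp_face u b ->
  0 <= t <= 1 -> supp_face u (a + t *: (b - a)).
Proof.
move=> [ca ha] [cb hb] t01; split => i; rewrite !mxE.
  by have := ca i; have := cb i; nra.
have [h1 h2] := ha i; have [h3 h4] := hb i; split => h.
  by rewrite (h1 h) (h3 h); ring.
by rewrite (h2 h) (h4 h); ring.
Qed.

Lemma cube_segment a b t : cube a -> cube b -> 0 <= t <= 1 ->
  cube (a + t *: (b - a)).
Proof. by move=> ca cb t01 i; have := ca i; have := cb i; rewrite !mxE; nra. Qed.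

Lemma supp_face_set_coord u i c : cube u -> u 0 i != 0 -> u 0 i != 1 ->
  0 <= c <= 1 -> supp_face u (set_coord u i c).
Proof.
move=> cu h0 h1 c01; split => j; rewrite mxE; first by case: eqP.
by case: eqP => [->|_]; split => // /eqP; rewrite ?(negbTE h0) ?(negbTE h1).
Qed.

Lemma supp_face_eq u v : cube u -> supp_face u v ->
  (forall i, u 0 i != 0 -> u 0 i != 1 -> v 0 i != 0 /\ v 0 i != 1) ->
  supp_face v = supp_face u.
Proof.
move=> cu [cv uv] h; apply/seteqP; split => w [cw hw]; split => // i;
  have [u0 u1] := uv i; have [w0 w1] := hw i; split => // e; move: (h i).
- by move=> _; apply/w0/u0.
- by move=> _; apply/w1/u1.
- have [/w0//|n0] := eqVneq (u 0 i) 0; have [/u1|n1] := eqVneq (u 0 i) 1.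
    by rewrite e => /eqP; rewrite eq_sym oner_eq0.
  by rewrite e eqxx => /(_ isT isT)[].
- have [/u0|n0] := eqVneq (u 0 i) 0; have [/w1//|n1] := eqVneq (u 0 i) 1.
    by rewrite e => /eqP; rewrite oner_eq0.
  by rewrite e eqxx => /(_ isT isT)[].
Qed.

(** A facet containing [v] but not [a] would be at distance at least [e] from [a]. *)
Lemma near_supp_face e a v : cube a -> margin e a -> cube v ->
  enorm (a - v) < e -> supp_face v a.
Proof.
move=> ca ma cv av; split => // i; have [m0 m1] := ma i.
have := le_lt_trans (ler_coord_enorm (a - v) i) av; rewrite !mxE => h.
split => vi; apply/eqP; rewrite -[_ == _]negbK; apply/negP.
  by move=> /m0; rewrite leNgt => /negP; apply; move: h; rewrite ltr_norml vi; lra.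
by move=> /m1; rewrite leNgt => /negP; apply; move: h; rewrite ltr_norml vi; lra.
Qed.

Lemma margin_near e d u v : margin e u -> supp_face v = supp_face u -> cube u ->
  cube v -> enorm (u - v) <= d -> margin (e - d) v.
Proof.
move=> mu uv cu cv d_uv i; have [m0 m1] := mu i.
have [_ hv] : supp_face u v by rewrite -uv; exact: supp_face_refl.
have [h0 h1] := hv i.
have := le_trans (ler_coord_enorm (u - v) i) d_uv; rewrite !mxE ler_norml => h.
split => ni.
  suff /m0 : u 0 i != 0 by lra.
  by apply: contra ni => /eqP/h0/eqP.
suff /m1 : u 0 i != 1 by lra.
by apply: contra ni => /eqP/h1/eqP.
Qed.

(** An affine form of the margin, hence one that isometries of faces respect. The ratio is extremal:
    for a coordinate [1 - e] of [u], it sends 0 to [(1 - e) (1 + e / (1 - e)) = 1]. *)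
Lemma margin_reflect e u a : 0 < e <= 2^-1 -> cube u -> margin e u ->
  supp_face u a -> supp_face u (u + (- (e / (1 - e))) *: (a - u)).
Proof.
move=> e01 cu mu [ca ha].
have e1 : 0 < 1 - e by lra.
have le : e / (1 - e) * (1 - e) = e by field; rewrite gt_eqF.
have l0 : 0 < e / (1 - e) by rewrite divr_gt0//; lra.
move: le l0; set l := e / (1 - e) => le l0.
split => i; have [h0 h1] := ha i; rewrite !mxE.
  have [m0 m1] := mu i; have := ca i.
  have [u0|/m0 n0] := eqVneq (u 0 i) 0; first by rewrite u0 (h0 u0) => _; nra.
  have [u1|/m1 n1] := eqVneq (u 0 i) 1; first by rewrite u1 (h1 u1) => _; nra.
  by move=> a01; nra.
split => ui; first by rewrite ui (h0 ui); ring.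
by rewrite ui (h1 ui); ring.
Qed.

End OneCube.

(** * Isometries between faces *)

Section FaceIsometry.
Variables (n k : nat) (u : 'rV[R]_n) (v : 'rV[R]_k) (h : 'rV[R]_n -> 'rV[R]_k).
Hypothesis h_im : h @` supp_face u = supp_face v.
Hypothesis h_iso : forall a b, supp_face u a -> supp_face u b ->
  eucl_dist (h a) (h b) = eucl_dist a b.

Lemma face_isometry_in a : supp_face u a -> supp_face v (h a).
Proof. by move=> ua; rewrite -h_im; exists a. Qed.

Lemma face_isometry_dotp a b c d : supp_face u a -> supp_face u b ->
  supp_face u c -> supp_face u d ->
  dotp (h a - h b) (h c - h d) = dotp (a - b) (c - d).
Proof.
move=> ua ub uc ud; apply: (@mulfI _ 2); first by rewrite pnatr_eq0.
by rewrite !dotp_polar -!eucl_distE !h_iso.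
Qed.

(* The squared norm of the defect is a combination of inner products that [h]
   preserves, hence the same as for the identity. *)
Lemma face_isometry_affine a b d (c : R) : supp_face u a -> supp_face u b ->
  supp_face u d -> supp_face u (a + c *: (b - d)) ->
  h (a + c *: (b - d)) = h a + c *: (h b - h d).
Proof.
move=> ua ub ud uabd; set x := a + _.
apply/eqP; rewrite -subr_eq0 -dotp_eq0 opprD addrA dotpBB.
rewrite !(dotpZl, dotpZr) !face_isometry_dotp//.
have -> : x - a = c *: (b - d) by rewrite /x addrC addKr.
rewrite !(dotpZl, dotpZr); apply/eqP; ring.
Qed.

(** The isometry transports the reflections of [margin_reflect]. Reflected points with [i]-th
    coordinate 0 and 1 stay in the cube, which bounds [h u 0 i] from above and from below. *)
Lemma face_isometry_margin e : 0 < e <= 2^-1 -> cube u -> margin e u -> cube v ->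
  forall i, v 0 i != 0 -> v 0 i != 1 -> e <= h u 0 i <= 1 - e.
Proof.
move=> e01 cu mu cv i v0 v1.
have huu := supp_face_refl cu.
have refl a' : supp_face v a' -> supp_face v (h u + (- (e / (1 - e))) *: (a' - h u)).
  rewrite -{1}h_im => -[a ua <-].
  have fa := margin_reflect e01 cu mu ua.
  by rewrite -face_isometry_affine//; exact: face_isometry_in.
have e1 : 0 < 1 - e by lra.
have le : e / (1 - e) * (1 - e) = e by field; rewrite gt_eqF.
have rc (c : R) : 0 <= c <= 1 ->
    0 <= h u 0 i - e / (1 - e) * (c - h u 0 i) <= 1.
  move=> c01; have [/(_ i) + _] := refl _ (supp_face_set_coord cv v0 v1 c01).
  by rewrite !mxE eqxx mulNr.
have /andP[_ H1] := rc 0 ltac:(by rewrite lexx ler01).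
have /andP[H2 _] := rc 1 ltac:(by rewrite lexx ler01).
have l0 : 0 < e / (1 - e) by rewrite divr_gt0//; lra.
move: H1 H2 le l0; set l := e / (1 - e); set y := h u 0 i => H1 H2 le l0.
have hl : (1 + l) * (1 - e) = 1 by lra.
have -> : y = (y - l * (0 - y)) * (1 - e) by rewrite -{1}(mulr1 y) -{1}hl; ring.
apply/andP; split; last by rewrite ler_piMl// ltW.
by rewrite -[leLHS]le ler_pM2r//; move: H2; lra.
Qed.

End FaceIsometry.
End Cubes.

(** * Cube complexes *)

Section Clamp.
Variable R : realType.

(** Extends a function on the unit interval to the line, where continuity is then stated before the
    extreme value theorem is applied. *)
Definition clamp01 (t : R) : R := if t < 0 then 0 else if 1 < t then 1 else t.

Lemma clamp01_itv t : 0 <= clamp01 t <= 1.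
Proof. by rewrite /clamp01; case: (ltP t 0); case: (ltP 1 t); lra. Qed.

Lemma clamp01_id t : 0 <= t <= 1 -> clamp01 t = t.
Proof. by rewrite /clamp01; case: (ltP t 0); case: (ltP 1 t); lra. Qed.

Lemma clamp01_lip s t : `|clamp01 s - clamp01 t| <= `|s - t|.
Proof.
have h := ler_norm (s - t); have := ler_norm (t - s); rewrite distrC => h'.
rewrite ler_norml /clamp01; case: (ltP s 0); case: (ltP 1 s);
  by case: (ltP t 0); case: (ltP 1 t) => *; apply/andP; split; lra.
Qed.

End Clamp.
Arguments clamp01 {R} t.

Section CubeComplexes.
Variables (R : realType) (X : metricType R) (K : cube_complex X).
Local Notation ch := (chart X K).
Local Notation dim := (cdim X K).

(** The gluing axiom does not provide [h u = v]. The transported margin puts [h u] in the relative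
    interior of the face of [v], where the chart is injective. *)
Lemma glue_isometry l m (u : 'rV_(dim l)) (v : 'rV_(dim m)) :
  cube u -> cube v -> ch l u = ch m v ->
  exists h : 'rV_(dim l) -> 'rV_(dim m),
    [/\ h @` supp_face u = supp_face v,
        forall a b, supp_face u a -> supp_face u b ->
          eucl_dist (h a) (h b) = eucl_dist a b,
        forall a, supp_face u a -> ch m (h a) = ch l a & h u = v].
Proof.
move=> cu cv uv; have [h [him hiso hch]] := chart_glue X K _ _ _ _ cu cv uv.
exists h; split => //.
have [e e01 mu] := exists_margin cu.
have fu := supp_face_refl cu.
have vhu := face_isometry_in him fu.
apply: (@chart_inj _ _ K) => //; [by case: vhu| |by rewrite hch].
apply: supp_face_eq => // i v0 v1.
have /andP[h0 h1] := face_isometry_margin him hiso e01 cu mu cv v0 v1.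
by split; apply/eqP => E; move: h0 h1; rewrite E; lra.
Qed.

Lemma glue_margin l m (u : 'rV_(dim l)) (v : 'rV_(dim m)) e :
  cube u -> cube v -> ch l u = ch m v -> 0 < e <= 2^-1 -> margin e u ->
  margin e v.
Proof.
move=> cu cv uv e01 mu i; have [h [him hiso _ huv]] := glue_isometry cu cv uv.
have := face_isometry_margin him hiso e01 cu mu cv (i := i); rewrite huv.
have [-> _|v0] := eqVneq (v 0 i) 0; first by split => // _; lra.
have [-> _|v1] := eqVneq (v 0 i) 1; first by split => // _; lra.
by move=> /(_ isT isT)/andP[].
Qed.

(** Being close to [v], the point [a] lies in the face of [v], which the two cells share, and the
    gluing isometry carries it over. *)
Lemma transfer l m (v a : 'rV_(dim l)) (w : 'rV_(dim m)) e :
  cube v -> cube w -> ch l v = ch m w -> cube a -> margin e a ->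
  enorm (a - v) < e ->
  exists a', [/\ cube a', ch m a' = ch l a & enorm (a' - w) = enorm (a - v)].
Proof.
move=> cv cw vw ca ma av; have [h [him hiso hch hvw]] := glue_isometry cv cw vw.
have va := near_supp_face ca ma cv av.
exists (h a); split; [|exact: hch|].
  by have [] := face_isometry_in him va.
by rewrite -hvw -!eucl_distE hiso//; exact: supp_face_refl.
Qed.

Lemma cube_string_ge0 x y r : cube_string ch x y r -> 0 <= r.
Proof.
by elim=> // l u v {}y {}r _ _ _ r0; rewrite addr_ge0// eucl_distE enorm_ge0.
Qed.

(* A short string cannot leave the star of [ch l a], so [a] can be followed
   from cell to cell along it. *)
Lemma develop x y r : cube_string ch x y r ->
  forall l (v a : 'rV_(dim l)) e, 0 < e <= 2^-1 -> cube v -> ch l v = y ->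
    cube a -> margin e a -> enorm (a - v) + r < e ->
  forall m (w : 'rV_(dim m)), cube w -> ch m w = x ->
  exists a', [/\ cube a', ch m a' = ch l a,
    enorm (a' - w) <= enorm (a - v) + r & enorm (a - v) - r <= enorm (a' - w)].
Proof.
elim=> {x y r} [x l v a e e01 cv vx ca ma|].
  rewrite addr0 => av m w cw wx.
  have [|a' [ca' aa' E]] := transfer cv cw _ ca ma av; first by rewrite vx.
  by exists a'; rewrite E subr0.
move=> l0 u0 v0 y r cu0 cv0 s IH l v a e e01 cv vy ca ma avr m w cw wx.
move: avr; rewrite eucl_distE => avr.
have r0 := cube_string_ge0 s; have uv0 := enorm_ge0 (u0 - v0).
have [|a0 [ca0 aa0 h1 h2]] := IH l v a e e01 cv vy ca ma _ l0 v0 cv0 erefl.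
  lra.
(* Each copy of [a] inherits the margin, so the admissible radius does not shrink along the
   string. *)
have ma0 : margin e a0 by apply: (glue_margin (u := a)).
have t1 : enorm (a0 - u0) <= enorm (a0 - v0) + enorm (u0 - v0).
  by rewrite (enormB u0); apply: le_trans (enormD _ _); rewrite addrA subrK.
have t2 : enorm (a0 - v0) <= enorm (a0 - u0) + enorm (u0 - v0).
  by apply: le_trans (enormD _ _); rewrite addrA subrK.
have [|a' [ca' aa' E]] := transfer cu0 cw (esym wx) ca0 ma0; first lra.
by exists a'; rewrite E; split; rewrite ?aa'//; lra.
Qed.

Lemma chart_dist_le l (u v : 'rV_(dim l)) : cube u -> cube v ->
  mdist (ch l u) (ch l v) <= enorm (u - v).
Proof.
move=> cu cv; rewrite -lee_fin (chart_dist X K).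
apply: ereal_inf_lbound; exists (eucl_dist u v + 0); last first.
  by rewrite addr0 eucl_distE.
by apply: cube_string_cons => //; exact: cube_string_nil.
Qed.

Lemma exists_cube_string x y d : mdist x y < d ->
  exists2 r, cube_string ch x y r & r < d.
Proof.
rewrite -lte_fin (chart_dist X K) => /ereal_inf_lt[_ [r s <-]].
by rewrite lte_fin => rd; exists r.
Qed.

(** Each point lies in the face of the other, so both are interior to one face, where the chart is
    injective. Injectivity on whole cubes rests on this through [local_dist]. *)
Lemma preimage_unique l (a a' : 'rV_(dim l)) e : 0 < e <= 2^-1 ->
  cube a -> cube a' -> margin e a -> ch l a = ch l a' -> enorm (a - a') < e ->
  a = a'.
Proof.
move=> e01 ca ca' ma aa' ae.
have [_ h1] := near_supp_face ca ma ca' ae.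
have [_ h2] : supp_face a a'.
  by apply: near_supp_face (glue_margin ca ca' aa' e01 ma) _ _ => //; rewrite enormB.
apply: (@chart_inj _ _ K) => //; apply/seteqP; split => w [cw hw]; split => // i;
  have [u0 u1] := hw i; have [h10 h11] := h1 i; have [h20 h21] := h2 i; split => E.
- exact/u0/h10.
- exact/u1/h11.
- exact/u0/h20.
- exact/u1/h21.
Qed.

(** A string shorter than the segment would develop [a] to a copy of itself in the same cube:
    [preimage_unique] identifies the two, whereas the lower bound of [develop] separates them. The
    factor 2 accommodates both the segment and the string. *)
Lemma local_dist l (a v : 'rV_(dim l)) e : 0 < e <= 2^-1 -> cube a -> cube v ->
  margin e a -> 2 * enorm (a - v) < e -> mdist (ch l a) (ch l v) = enorm (a - v).
Proof.
move=> e01 ca cv ma av; apply/eqP; rewrite eq_le chart_dist_le//=.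
rewrite leNgt; apply/negP => /exists_cube_string[r s ra].
have [|a' [ca' aa' h1 h2]] := develop s e01 cv erefl ca ma _ ca erefl; first lra.
have aE : a = a' by apply: preimage_unique e01 ca ca' ma _ _ => //; rewrite enormB; lra.
by move: h2; rewrite -aE subrr enorm0; lra.
Qed.

(** Used to find the base point in any cell met nearby; a short string from [x] develops [a] into
    that cell. *)
Lemma near_preimage l (a : 'rV_(dim l)) x m (w : 'rV_(dim m)) e :
  0 < e <= 2^-1 -> cube a -> margin e a -> 2 * mdist (ch l a) x < e ->
  cube w -> ch m w = x ->
  exists a', [/\ cube a', ch m a' = ch l a, margin e a'
    & enorm (a' - w) = mdist (ch l a) x].
Proof.
move=> e01 ca ma ax cw wx.
have [|r s re] := @exists_cube_string x (ch l a) (e / 2).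
  by rewrite (metric_sym x); lra.
have [|a' [ca' aa' h _]] := develop s e01 ca erefl ca ma _ cw wx.
  by rewrite subrr enorm0; lra.
have ma' := glue_margin ca ca' (esym aa') e01 ma.
exists a'; split => //; rewrite -aa' -wx (local_dist e01)//.
by move: h; rewrite subrr enorm0; lra.
Qed.

Hypothesis cat0X : CAT0 X.

(* If u <> v had the same image w, the segment from u to v would map to a loop
   at w which is locally geodesic away from w, since its inner points lie in
   the interior of a common face. By the CN inequality the distance to w has no
   interior maximum along this loop, which would hence be constant. *)
Lemma chart_injective l (u v : 'rV_(dim l)) : cube u -> cube v ->
  ch l u = ch l v -> u = v.
Proof.
move=> cu cv uv; apply/eqP; case: eqVneq => // u_v; exfalso.
pose p t := u + t *: (v - u).
have cp t : 0 <= t <= 1 -> cube (p t) by move=> h; apply: cube_segment.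
have itvW (t : R) : 0 < t < 1 -> 0 <= t <= 1 by case/andP => /ltW -> /ltW ->.
have pB s t : enorm (p s - p t) = `|s - t| * enorm (v - u).
  by rewrite -enormZ; congr enorm; apply/rowP => i; rewrite !mxE; ring.
have fp s t : 0 < s < 1 -> 0 < t < 1 -> supp_face (p s) = supp_face (p t).
  move=> hs ht; apply: supp_face_eq; first exact/cp/itvW.
    split; first exact/cp/itvW.
    move=> i; rewrite !mxE; have := cu i; have := cv i.
    move: (u 0 i) (v 0 i) => a b a01 b01; split => h.
      have -> : a = 0 by nra.
      have -> : b = 0 by nra.
      by ring.
    have -> : a = 1 by nra.
    have -> : b = 1 by nra.
    by ring.
  move=> i; rewrite !mxE; have := cu i; have := cv i.
  move: (u 0 i) (v 0 i) => a b a01 b01 n0 n1.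
  have n0' : ~ (a = 0 /\ b = 0).
    by move=> [a0 b0]; move/eqP: n0; apply; rewrite a0 b0; ring.
  have n1' : ~ (a = 1 /\ b = 1).
    by move=> [a1 b1]; move/eqP: n1; apply; rewrite a1 b1; ring.
  split; apply/eqP => E; [apply: n0'|apply: n1']; split; nra.
have D0 : 0 < enorm (v - u).
  by rewrite lt_neqAle enorm_ge0 eq_sym enorm_eq0 subr_eq0 eq_sym u_v.
pose f t := mdist (ch l u) (ch l (p t)).
have pu : p 0 = u by rewrite /p scale0r addr0.
have pv : p 1 = v by rewrite /p scale1r addrC subrK.
have f0 : f 0 = 0 by rewrite /f pu mdistxx.
have f1 : f 1 = 0 by rewrite /f pv uv mdistxx.
have f_lip s t : 0 <= s <= 1 -> 0 <= t <= 1 -> `|f s - f t| <= `|s - t| * enorm (v - u).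
  move=> hs ht; have := chart_dist_le (cp s hs) (cp t ht); rewrite pB.
  have h1 := metric_triangle (ch l u) (ch l (p s)) (ch l (p t)).
  have h2 := metric_triangle (ch l u) (ch l (p t)) (ch l (p s)).
  move: h1 h2; rewrite (metric_sym (ch l (p t)) (ch l (p s))) -/(f s) -/(f t) => h1 h2 h3.
  by rewrite ler_norml; apply/andP; split; lra.
have [c c01 fmax] : exists2 c, 0 <= c <= 1 & forall t, 0 <= t <= 1 -> f t <= f c.
  have cg : continuous (f \o clamp01).
    move=> x; apply/cvgrPdist_lt => e e0; apply/nbhs_ballP.
    exists (e / enorm (v - u)); first by rewrite /= divr_gt0.
    move=> y; rewrite /ball /= ltr_pdivlMr// => xy.
    apply: le_lt_trans (f_lip _ _ (clamp01_itv _) (clamp01_itv _)) (le_lt_trans _ xy).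
    by rewrite ler_pM2r// clamp01_lip.
  have [c + cmax] := @EVT_max R (f \o clamp01) 0 1 ler01 (continuous_subspaceT cg).
  rewrite in_itv/= => c01; exists c => // t t01.
  by have := cmax t; rewrite in_itv/= t01 => /(_ isT); rewrite !clamp01_id.
have fc : f c = 0.
  have [->//|c0] := eqVneq c 0; have [->//|c1] := eqVneq c 1.
  have hc : 0 < c < 1 by rewrite !lt_neqAle eq_sym c0 c1.
  have [e e01 me] := exists_margin (cp c c01).
  (* The half-chord is at most [e / 8]: the margin left at [p (c - r)] is [e - e / 8], and twice the
     chord is at most [e / 2], as [local_dist] demands. *)
  pose r := Num.min (Num.min (c / 2) ((1 - c) / 2)) (e / (8 * enorm (v - u))).
  have r0 : 0 < r by rewrite !lt_min !divr_gt0// ?mulr_gt0//; lra.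
  have rc : r <= c / 2 by rewrite !ge_min lexx.
  have rc1 : r <= (1 - c) / 2 by rewrite !ge_min lexx orbT.
  have re : r * enorm (v - u) <= e / 8.
    rewrite -ler_pdivlMr// (_ : e / 8 / _ = e / (8 * enorm (v - u))).
      by rewrite ge_min lexx orbT.
    by field; rewrite gt_eqF.
  have c1p : 0 < c - r < 1 by lra.
  have c2p : 0 < c + r < 1 by lra.
  have cp1 := cp _ (itvW _ c1p).
  have cp2 := cp _ (itvW _ c2p).
  have n1 : enorm (p c - p (c - r)) = r * enorm (v - u).
    by rewrite pB opprB addrC subrK gtr0_norm.
  have n2 : enorm (p c - p (c + r)) = r * enorm (v - u).
    by rewrite pB opprD addrA subrr sub0r normrN gtr0_norm.
  have n12 : enorm (p (c - r) - p (c + r)) = 2 * r * enorm (v - u).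
    rewrite pB (_ : c - r - (c + r) = - (2 * r)); last by ring.
    by rewrite normrN gtr0_norm// mulr_gt0.
  have m1 : margin (e - e / 8) (p (c - r)).
    by apply: margin_near me (fp _ _ c1p hc) (cp _ c01) cp1 _; rewrite n1.
  have d1 := chart_dist_le cp1 (cp _ c01).
  have d2 := chart_dist_le (cp _ c01) cp2.
  have d12 : mdist (ch l (p (c - r))) (ch l (p (c + r))) = 2 * r * enorm (v - u).
    by rewrite -n12 (local_dist (e := e - e / 8))// ?n12; lra.
  have h2 : 0 <= (2^-1 : R) <= 1 by lra.
  have := CN_inequality cat0X (ch l u) h2 (m := ch l (p c)) (x := ch l (p (c - r)))
    (y := ch l (p (c + r))).
  rewrite d12 -/(f _) -/(f _) -/(f _) => /(_ _ _)/wrap[].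
  - by apply: le_trans d1 _; rewrite enormB n1; lra.
  - by apply: le_trans d2 _; rewrite n2; lra.
  have f1' := fmax _ (itvW _ c1p); have f2' := fmax _ (itvW _ c2p).
  have s1 : f (c - r) ^+ 2 <= f c ^+ 2 by rewrite ler_sqr ?nnegrE ?mdist_ge0.
  have s2 : f (c + r) ^+ 2 <= f c ^+ 2 by rewrite ler_sqr ?nnegrE ?mdist_ge0.
  have : 0 < (2 * r * enorm (v - u)) ^+ 2 by rewrite exprn_gt0// !mulr_gt0.
  lra.
have fz t : 0 <= t <= 1 -> ch l (p t) = ch l u.
  move=> t01; apply/esym/mdist_positivity/eqP; rewrite eq_le mdist_ge0 andbT.
  by rewrite -fc fmax.
(* The segment is collapsed to a point, although its inner points are all interior to one face; the
   choice of two inner parameters is arbitrary. *)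
have /eqP : p (3^-1) = p (2^-1).
  have t1 : 0 < (3^-1 : R) < 1 by lra.
  have t2 : 0 < (2^-1 : R) < 1 by lra.
  apply: (@chart_inj _ _ K); [exact/cp/itvW|exact/cp/itvW|exact: fp|].
  by rewrite !fz// itvW.
rewrite -subr_eq0 -enorm_eq0 pB mulf_eq0 (gt_eqF D0) orbF normr_eq0.
by move/eqP; lra.
Qed.

End CubeComplexes.

(** * Edge directions *)

Section Axes.
Variable R : realType.

Definition axis n (t : bool * 'I_n) : 'rV[R]_n :=
  (if t.1 then 1 else -1) *: delta_mx 0 t.2.

(** Opposite directions get separate nonnegative components, so that edge directions can serve as
    coordinates. *)
Definition axis_part n (t : bool * 'I_n) (h : 'rV[R]_n) : R :=
  Num.max 0 (dotp h (axis t)).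

(* The tangent cone of the cube at [a]. *)
Definition tangent n (a h : 'rV[R]_n) : Prop :=
  forall i, (a 0 i = 0 -> 0 <= h 0 i) /\ (a 0 i = 1 -> h 0 i <= 0).

Section Dimension.
Variable n : nat.
Implicit Types (t : bool * 'I_n) (a h k : 'rV[R]_n).

Lemma axisE t i : axis t 0 i = if i == t.2 then (if t.1 then 1 else -1) else 0.
Proof. by rewrite !mxE eqxx /=; case: (i == t.2); rewrite ?mulr1 ?mulr0. Qed.

Lemma axis_inj : injective (@axis n).
Proof.
have n1 : (1 : R) <> -1 by lra.
move=> [c i] [d j] /rowP/(_ i); rewrite !axisE eqxx /=.
case: eqP => [->|_]; first by case: c; case: d => // /esym.
by case: c => /eqP; rewrite ?oppr_eq0 oner_eq0.
Qed.

Lemma dotp_axis h t : dotp h (axis t) = (if t.1 then 1 else -1) * h 0 t.2.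
Proof. by rewrite dotpZr dotp_delta. Qed.

Lemma dotp_axis_axis t : dotp (axis t) (axis t) = 1.
Proof. by rewrite dotp_axis axisE eqxx; case: t.1; ring. Qed.

Lemma axis_part_ge0 t h : 0 <= axis_part t h.
Proof. by rewrite /axis_part le_max lexx. Qed.

Lemma axis_part_gt0 t h : (0 < axis_part t h) = (0 < dotp h (axis t)).
Proof. by rewrite /axis_part lt_max ltxx. Qed.

Lemma axis_partE t h : 0 < axis_part t h -> axis_part t h = dotp h (axis t).
Proof. by rewrite axis_part_gt0 /axis_part => /ltW/max_r. Qed.

Lemma axis_partZ t h (c : R) : 0 <= c -> axis_part t (c *: h) = c * axis_part t h.
Proof. by move=> c0; rewrite /axis_part dotpZl maxr_pMr// mulr0. Qed.

Lemma sum_axes (V : nmodType) (F : bool * 'I_n -> V) :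
  \sum_t F t = \sum_i (F (true, i) + F (false, i)).
Proof.
rewrite (eq_bigr (fun t => F (t.1, t.2))); last by case.
rewrite -(pair_bigA _ (fun c i => F (c, i)))/= big_bool -big_split/=.
by apply: eq_bigr.
Qed.

Lemma axis_partTE h i : axis_part (true, i) h = Num.max 0 (h 0 i).
Proof. by rewrite /axis_part dotp_axis mul1r. Qed.

Lemma axis_partFE h i : axis_part (false, i) h = Num.max 0 (- h 0 i).
Proof. by rewrite /axis_part dotp_axis mulN1r. Qed.

Lemma sum_part h : h = \sum_t axis_part t h *: axis t.
Proof.
apply/rowP => i; rewrite summxE sum_axes (bigD1 i)//= big1 ?addr0.
  rewrite !mxE !eqxx /= axis_partTE axis_partFE.
  by case: (leP 0 (h 0 i)) => ?; case: (leP 0 (- h 0 i)) => ?; lra.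
by move=> j ji; rewrite !mxE eq_sym (negbTE ji) /=; ring.
Qed.

(** Splitting reals into positive and negative parts only shortens: for opposite signs the term
    [- 2 x y >= 0] is lost. For equal signs nothing is lost ([sum_part_eq]). *)
Lemma sum_part_le h k : \sum_t (axis_part t h - axis_part t k) ^+ 2 <= enorm (h - k) ^+ 2.
Proof.
rewrite enorm_sqr sum_axes; apply: ler_sum => i _.
rewrite !axis_partTE !axis_partFE !mxE; move: (h 0 i) (k 0 i) => x y.
by case: (leP 0 x) => ?; case: (leP 0 (- x)) => ?; case: (leP 0 y) => ?;
  case: (leP 0 (- y)) => ?; nra.
Qed.

Lemma sum_part_eq h k : (forall i, 0 <= h 0 i * k 0 i) ->
  \sum_t (axis_part t h - axis_part t k) ^+ 2 = enorm (h - k) ^+ 2.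
Proof.
move=> hk; rewrite enorm_sqr sum_axes; apply: eq_bigr => i _; have := hk i.
rewrite !axis_partTE !axis_partFE !mxE; move: (h 0 i) (k 0 i) => x y xy.
case: (leP 0 x) => hx; case: (leP 0 (- x)) => hx'; case: (leP 0 y) => hy;
  case: (leP 0 (- y)) => hy'; try ring.
all: try (have x0 : x = 0 by lra); try (have y0 : y = 0 by lra).
all: rewrite ?x0 ?y0; try ring; exfalso; nra.
Qed.

Lemma tangent_cubeB a v : cube v -> tangent a (v - a).
Proof. by move=> cv i; have := cv i; rewrite !mxE => ?; split=> ->; lra. Qed.

Lemma cube_tangent e a h : cube a -> margin e a -> e <= 2^-1 -> tangent a h ->
  (forall i, `|h 0 i| <= e) -> cube (a + h).
Proof.
move=> ca ma e1 th he i; have := he i; rewrite ler_norml !mxE => hi.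
have [m0 m1] := ma i; have [t0 t1] := th i; have := ca i => ai.
have [a0|/m0 n0] := eqVneq (a 0 i) 0; first by have := t0 a0; lra.
have [a1|/m1 n1] := eqVneq (a 0 i) 1; first by have := t1 a1; lra.
by lra.
Qed.

Lemma tangentZ a h (c : R) : 0 <= c -> tangent a h -> tangent a (c *: h).
Proof.
move=> c0 th i; have [t0 t1] := th i; rewrite mxE; split => [/t0|/t1] h0.
  by rewrite mulr_ge0.
by rewrite mulr_ge0_le0.
Qed.

Lemma tangent_axis a h t : tangent a h -> 0 < axis_part t h -> tangent a (axis t).
Proof.
move=> th; rewrite axis_part_gt0 dotp_axis => p i; have [t0 t1] := th i.
rewrite axisE; case: (eqVneq i t.2) => [E|_]; last by split => _.
by case: t.1 p; rewrite -E => p; split => // ai;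
  [have := t1 ai|have := t0 ai]; lra.
Qed.

Lemma ler_coord_axis t (c : R) i : 0 <= c -> `|(c *: axis t) 0 i| <= c.
Proof.
move=> c0; rewrite mxE axisE; case: eqP => _; last by rewrite mulr0 normr0.
by rewrite normrM ger0_norm//; case: t.1; rewrite ?normrN normr1 mulr1.
Qed.

Lemma enorm_axis t (c : R) : 0 <= c -> enorm (c *: axis t) = c.
Proof.
move=> c0; rewrite enormZ ger0_norm// -[RHS]mulr1; congr (_ * _).
by rewrite /enorm dotp_axis_axis sqrtr1.
Qed.

End Dimension.

(** As [f] is injective where [d] does not vanish, each inner sum has at most one nonzero term. This
    turns a norm indexed by points of the complex into one indexed by the axes of a cell. *)
Lemma sum_fibers (T : finType) (X : choiceType) (f : T -> X) (d : T -> R)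
    (W : seq X) : uniq W ->
  (forall t t', d t != 0 -> d t' != 0 -> f t = f t' -> t = t') ->
  \sum_(w <- W) (\sum_t (f t == w)%:R * d t) ^+ 2 =
  \sum_t (f t \in W)%:R * d t ^+ 2.
Proof.
move=> uW inj.
have E w : (\sum_t (f t == w)%:R * d t) ^+ 2 = \sum_t (f t == w)%:R * d t ^+ 2.
  case: (pickP [pred t | (f t == w) && (d t != 0)]) => [t0 /andP[/eqP fw d0]|no].
    have z t : t != t0 -> (f t == w)%:R * d t = 0.
      have [->|dt] := eqVneq (d t) 0; first by rewrite mulr0.
      have [ft|_] := eqVneq (f t) w; last by rewrite mul0r.
      by move=> /eqP[]; apply: inj; rewrite ?ft.
    rewrite (bigD1 t0)//= [RHS](bigD1 t0)//= !big1 ?addr0 ?fw ?eqxx ?mul1r//.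
    by move=> t /z; case: eqP; rewrite ?mul1r ?mul0r// => _ ->; rewrite expr0n.
  have z t : (f t == w)%:R * d t = 0.
    have := no t; rewrite /=; case: eqP => _; rewrite ?mul0r//=.
    by move=> /negbFE/eqP->; rewrite mulr0.
  rewrite big1 ?expr0n//= big1// => t _.
  by have := z t; case: eqP; rewrite ?mul1r ?mul0r// => _ ->; rewrite expr0n.
rewrite (eq_bigr _ (fun w _ => E w)) exchange_big /=; apply: eq_bigr => t _.
rewrite -mulr_suml; congr (_ * _); rewrite -natr_sum; congr (_%:R).
rewrite -count_uniq_mem// -sum1_count [RHS]big_mkcond; apply: eq_bigr => w _.
by rewrite eq_sym /=; case: eqP.
Qed.

Section FaceIsometryAxis.
Variables (n k : nat) (u : 'rV[R]_n) (v : 'rV[R]_k) (h : 'rV[R]_n -> 'rV[R]_k).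
Hypothesis h_im : h @` supp_face u = supp_face v.
Hypothesis h_iso : forall a b, supp_face u a -> supp_face u b ->
  eucl_dist (h a) (h b) = eucl_dist a b.

(* A segment of a cube is parallel to an axis if and only if every point of the
   cube can be moved a bit in its direction, one way or the other. *)
Lemma face_isometry_axis a t s : cube v -> 0 < s ->
  u 0 t.2 != 0 -> u 0 t.2 != 1 ->
  supp_face u a -> supp_face u (a + s *: axis t) ->
  exists t', h (a + s *: axis t) = h a + s *: axis t'.
Proof.
move=> cv s0 u0 u1 ua ub; set b := a + _.
have bE : b - a = s *: axis t by rewrite /b addrC addKr.
have sN0 : s != 0 by rewrite gt_eqF.
set x := h b - h a.
have move_x p' : supp_face v p' -> exists2 c, c != 0 & supp_face v (p' + c *: x).
  rewrite -{1}h_im => -[p up <-].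
  (* [d] moves the free coordinate by one half to the side that has room, and [c] writes this move
     as a multiple of [b - a]. *)
  pose d : R := if p 0 t.2 <= 2^-1 then 2^-1 else - 2^-1.
  pose c := (if t.1 then 1 else -1) * d / s.
  exists c.
    rewrite !mulf_neq0 ?invr_eq0// /d; first by case: t.1; rewrite ?oppr_eq0 oner_eq0.
    by case: ifP => _; rewrite ?oppr_eq0 invr_eq0 pnatr_eq0.
  have up' : supp_face u (p + c *: (b - a)).
    have E i : (p + c *: (b - a)) 0 i = p 0 i + (if i == t.2 then d else 0).
      rewrite bE 3!mxE axisE; case: eqP => _; last by rewrite !mulr0.
      by rewrite /c; case: t.1; field.
    have [cp hp] := up; split => i; rewrite E; case: eqP => [->|_].
    - by rewrite /d; have := cp t.2; case: ifP => [|/negbT]; rewrite -?ltNge; lra.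
    - by rewrite addr0.
    - by split => /eqP E'; [rewrite E' in u0|rewrite E' in u1].
    - by rewrite addr0.
  by rewrite -(face_isometry_affine h_iso)//; exact: (face_isometry_in h_im).
have x_free i : x 0 i != 0 -> v 0 i != 0 /\ v 0 i != 1.
  have [_ /(_ i)[ha0 ha1]] := face_isometry_in h_im ua.
  have [_ /(_ i)[hb0 hb1]] := face_isometry_in h_im ub.
  rewrite !mxE -/b => xi; split; apply: contra xi => /eqP vi.
    by rewrite ha0// hb0// subrr.
  by rewrite ha1// hb1// subrr.
have xx : dotp x x = s ^+ 2.
  rewrite (face_isometry_dotp h_iso)// bE dotpZl dotpZr dotp_axis_axis.
  by rewrite mulr1 expr2.
have xE : h b = h a + x by rewrite /x addrC subrK.
clearbody x.
have x_one i j : i != j -> x 0 i != 0 -> x 0 j = 0.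
  move=> ij xi; apply/eqP; case: (eqVneq (x 0 j) 0) => // xj; exfalso.
  have [vi0 vi1] := x_free _ xi; have [vj0 vj1] := x_free _ xj.
  (* From a point with [i]-th coordinate 0 and [j]-th coordinate [e], moving along [x] in either
     sense forces one of the two out of the unit interval. *)
  pose e : R := if 0 < x 0 i * x 0 j then 1 else 0.
  have [] := move_x (set_coord (set_coord v i 0) j e).
    split => l; rewrite !mxE.
      case: eqP => _; first by rewrite /e; case: ifP => _; rewrite ?lexx ler01.
      by case: eqP => _; [rewrite lexx ler01|exact: cv].
    case: eqP => [->|_]; first by split => /eqP E; [rewrite E in vj0|rewrite E in vj1].
    by case: eqP => [->|_]; first by split => /eqP E; [rewrite E in vi0|rewrite E in vi1].
  move=> c c0 [cc _]; have := cc i; have := cc j; rewrite !mxE !eqxx (negbTE ij) /e.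
  move: xi xj {e cc}; move: (x 0 i) (x 0 j).
  move=> y z y0 z0; have yz : y * z != 0 by rewrite mulf_neq0.
  have c2 : 0 < c ^+ 2 by rewrite exprn_even_gt0.
  case: ifP => [p|/negbT]; last rewrite -leNgt le_eqVlt (negbTE yz)/= => p;
    move=> /andP[h1 h2] /andP[h3 h4].
    have : c ^+ 2 * (y * z) <= 0 by nra.
    by rewrite leNgt mulr_gt0.
  have : 0 <= c ^+ 2 * (y * z) by nra.
  by rewrite leNgt pmulr_rlt0// p.
have [i xi] : exists i, x 0 i != 0.
  apply/existsP; rewrite -negb_forall; apply/negP => /forallP x0.
  have : dotp x x = 0 by rewrite /dotp big1// => i _; rewrite (eqP (x0 i)) mul0r.
  by rewrite xx => /eqP; rewrite sqrf_eq0 (negbTE sN0).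
have xi2 : x 0 i ^+ 2 = s ^+ 2.
  rewrite -xx /dotp (bigD1 i)//= big1 ?addr0 ?expr2// => j ji.
  by rewrite (x_one i j) ?mul0r// eq_sym.
exists (0 < x 0 i, i); rewrite xE; congr (_ + _); apply/rowP => j.
rewrite mxE axisE; case: (eqVneq j i) => [->|ji] /=; last first.
  by rewrite mulr0 (x_one i)// eq_sym.
move/eqP: xi2; rewrite eqf_sqr => /orP[] /eqP ->.
  by rewrite s0 mulr1.
by rewrite oppr_gt0 ltNge ltW//= mulrN1.
Qed.

End FaceIsometryAxis.
End Axes.
Arguments axis {R n} t.

(** * Coordinates near a point *)

Section LocalCone.
Variables (R : realType) (X : metricType R) (K : cube_complex X).
Hypothesis cat0X : CAT0 X.
Local Notation ch := (chart X K).
Local Notation dim := (cdim X K).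
Variables (b : X) (e : R).
Hypothesis e01 : 0 < e <= 2^-1.
Hypothesis b_margin : forall l (a : 'rV_(dim l)), cube a -> ch l a = b -> margin e a.

Let e0 : 0 < e. Proof. by case/andP: e01. Qed.
Let s : R := e / 2.
Let s0 : 0 < s. Proof. by rewrite divr_gt0. Qed.
Let s_le : 0 <= s <= e.
Proof. by rewrite ltW//= ler_pdivrMr// ler_peMr ?ler1n// ltW. Qed.

Definition at_base l (a : 'rV_(dim l)) : Prop := cube a /\ ch l a = b.

Lemma at_base_unique l (a a' : 'rV_(dim l)) : at_base a -> at_base a' -> a = a'.
Proof. by move=> [ca aE] [ca' aE']; apply: (chart_injective cat0X); rewrite ?aE. Qed.

(** The base point lies in the face of any point close to it, so the gluing isometry at that point
    carries it along; its image is [a'] since charts are injective. *)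
Lemma base_glue l m (a h : 'rV_(dim l)) (a' k : 'rV_(dim m)) :
  at_base a -> at_base a' -> cube (a + h) -> cube (a' + k) -> enorm h < e ->
  ch l (a + h) = ch m (a' + k) ->
  exists f : 'rV_(dim l) -> 'rV_(dim m),
    [/\ f @` supp_face (a + h) = supp_face (a' + k),
        forall p q, supp_face (a + h) p -> supp_face (a + h) q ->
          eucl_dist (f p) (f q) = eucl_dist p q,
        forall p, supp_face (a + h) p -> ch m (f p) = ch l p,
        f (a + h) = a' + k & supp_face (a + h) a /\ f a = a'].
Proof.
move=> ba ba' cah cak he E; have [f [f_im f_iso f_ch f_ah]] := glue_isometry cah cak E.
have [ca aE] := ba.
have fa : supp_face (a + h) a.
  apply: (near_supp_face ca (b_margin ca aE) cah).
  by rewrite opprD addrA subrr sub0r enormN.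
exists f; split => //; split => //; apply: at_base_unique => //.
by split; [have [] := face_isometry_in f_im fa|rewrite f_ch].
Qed.

Lemma base_glue_norm l m (a h : 'rV_(dim l)) (a' k : 'rV_(dim m)) :
  at_base a -> at_base a' -> cube (a + h) -> cube (a' + k) -> enorm h < e ->
  ch l (a + h) = ch m (a' + k) -> enorm k = enorm h.
Proof.
move=> ba ba' cah cak he E.
have [f [_ f_iso _ fh [fa fa']]] := base_glue ba ba' cah cak he E.
have := f_iso _ _ (supp_face_refl cah) fa; rewrite fh fa' !eucl_distE.
by rewrite ![_ + _ - _]addrC !addKr.
Qed.

Lemma cube_axis l (a : 'rV_(dim l)) t c : at_base a -> tangent a (axis t) ->
  0 <= c <= e -> cube (a + c *: axis t).
Proof.
move=> [ca aE] ta c0e; have e1 : e <= 2^-1 by case/andP: e01.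
apply: (cube_tangent ca (b_margin ca aE) e1); first by apply: tangentZ => //; lra.
by move=> i; apply: le_trans (ler_coord_axis t i _) _; lra.
Qed.

(** The gluing isometry sends axes to axes by [face_isometry_axis] and preserves inner products with
    them, hence components. *)
Lemma axis_transfer l m (a h : 'rV_(dim l)) (a' k : 'rV_(dim m)) t :
  at_base a -> at_base a' -> cube (a + h) -> cube (a' + k) -> enorm h < e ->
  ch l (a + h) = ch m (a' + k) -> 0 < axis_part t h ->
  exists t', axis_part t' k = axis_part t h /\ ch m (a' + s *: axis t') = ch l (a + s *: axis t).
Proof.
move=> ba ba' cah cak he E ht.
have [f [f_im f_iso f_ch fh [fa fa']]] := base_glue ba ba' cah cak he E.
have [ca aE] := ba; have := ca t.2; have [m0 m1] := b_margin ca aE t.2.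
have tah := tangent_cubeB a cah; rewrite addrC addKr in tah.
have [t0 t1] := tah t.2.
have := ler_coord_enorm h t.2; rewrite ler_norml => hle a01.
move: ht; rewrite axis_part_gt0 dotp_axis => ht.
have h0 : h 0 t.2 != 0 by apply/eqP => hE; move: ht; rewrite hE mulr0 ltxx.
have hN0 : ~ h 0 t.2 = 0 by exact/eqP.
(* The displacement [h 0 t.2] is nonzero and smaller than [e] in absolute value: it leaves any facet
   at [a] and reaches no other. *)
have free : (a + h) 0 t.2 != 0 /\ (a + h) 0 t.2 != 1.
  rewrite !mxE; move: m0 m1 t0 t1 a01 hle hN0; move: (a 0 t.2) (h 0 t.2) => x y.
  move=> m0 m1 t0 t1 a01 hle y0.
  have [x0|/m0 x0] := eqVneq x 0; last have [x1|/m1 x1] := eqVneq x 1.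
  - by have := t0 x0; split; apply/eqP => z; [apply: y0|]; lra.
  - by have := t1 x1; split; apply/eqP => z; [|apply: y0]; lra.
  - by split; apply/eqP => z; lra.
have ht' : 0 < axis_part t h by rewrite axis_part_gt0 dotp_axis.
have cax : cube (a + s *: axis t).
  by apply: cube_axis => //; exact: tangent_axis tah ht'.
have fax : supp_face (a + h) (a + s *: axis t).
  have [_ ha] := fa; split => // i.
  have -> : (a + s *: axis t) 0 i = a 0 i + s * axis t 0 i by rewrite 2!mxE.
  rewrite axisE; case: eqP => [->|_]; last by rewrite mulr0 addr0.
  by case: free => /eqP f0 /eqP f1; split.
have [t' ft'] := face_isometry_axis f_im f_iso cak s0 free.1 free.2 fa fax.
exists t'; split; last by rewrite -(f_ch _ fax) ft' fa'.
have := face_isometry_dotp f_iso (supp_face_refl cah) fa fax fa.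
rewrite ft' fh fa' ![_ + _ - _]addrC !addKr !(dotpZr s) => /(mulfI (lt0r_neq0 s0)) D.
by rewrite axis_partE ?axis_part_gt0 D -?axis_part_gt0// -axis_partE.
Qed.

(** The component of [h] in the direction named by [w]. Naming directions by points of [X] makes
    cells comparable; for tangent [h] at the base point, [coordinate_inj] leaves at most one nonzero
    term. *)
Definition coordinate l (a h : 'rV_(dim l)) (w : X) : R :=
  \sum_t (ch l (a + s *: axis t) == w)%:R * axis_part t h.

Lemma coordinate_inj l (a h : 'rV_(dim l)) t t' : at_base a -> tangent a h ->
  0 < axis_part t h -> tangent a (axis t') ->
  ch l (a + s *: axis t) = ch l (a + s *: axis t') -> t = t'.
Proof.
move=> ba th ht ht' /(chart_injective cat0X) E; apply: axis_inj.
have /addrI : a + s *: axis t = a + s *: axis t'.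
  by apply: E; apply: cube_axis => //; exact: tangent_axis th _.
by move=> tE; exact: scalerI (lt0r_neq0 s0) _ _ tE.
Qed.

Lemma coordinate_axis l (a h : 'rV_(dim l)) t : at_base a -> tangent a h ->
  0 < axis_part t h -> coordinate a h (ch l (a + s *: axis t)) = axis_part t h.
Proof.
move=> ba th ht; rewrite /coordinate (bigD1 t)//= eqxx mul1r big1 ?addr0// => t' tt'.
have := axis_part_ge0 t' h; rewrite le_eqVlt => /predU1P[<-|ht']; first by rewrite mulr0.
case: eqP => [E|_]; last by rewrite mul0r.
case/eqP: tt'; apply/esym; apply: (coordinate_inj ba th ht) => //.
exact: tangent_axis th ht'.
Qed.

Lemma coordinate_ge0 l (a h : 'rV_(dim l)) w : 0 <= coordinate a h w.
Proof. by apply: sumr_ge0 => t _; rewrite mulr_ge0 ?axis_part_ge0. Qed.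

Lemma coordinate_gt0 l (a h : 'rV_(dim l)) w : 0 < coordinate a h w ->
  exists2 t, 0 < axis_part t h & ch l (a + s *: axis t) = w.
Proof.
move=> /gt_eqF/negbT; rewrite /coordinate psumr_neq0 => [|t _]; last first.
  by rewrite mulr_ge0 ?axis_part_ge0.
move=> /hasP[t _] /=; case: eqP => [E|_]; last by rewrite mul0r ltxx.
by rewrite mul1r => ht; exists t.
Qed.

Lemma coordinateZ l (a h : 'rV_(dim l)) w c : 0 <= c ->
  coordinate a (c *: h) w = c * coordinate a h w.
Proof.
move=> c0; rewrite /coordinate mulr_sumr; apply: eq_bigr => t _.
by rewrite axis_partZ// mulrCA.
Qed.

Lemma coordinate_glue l m (a h : 'rV_(dim l)) (a' k : 'rV_(dim m)) w :
  at_base a -> at_base a' -> cube (a + h) -> cube (a' + k) -> enorm h < e ->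
  ch l (a + h) = ch m (a' + k) -> coordinate a h w = coordinate a' k w.
Proof.
(* [axis_transfer] follows positive components only; used in both directions, it settles the zero
   ones too. *)
have step l1 m1 (a1 h1 : 'rV_(dim l1)) (a2 k2 : 'rV_(dim m1)) :
  at_base a1 -> at_base a2 -> cube (a1 + h1) -> cube (a2 + k2) -> enorm h1 < e ->
  ch l1 (a1 + h1) = ch m1 (a2 + k2) -> 0 < coordinate a1 h1 w ->
  coordinate a1 h1 w = coordinate a2 k2 w.
  move=> ba1 ba2 c1 c2 he E /coordinate_gt0[t ht tw].
  have [t' [tt' tw']] := axis_transfer ba1 ba2 c1 c2 he E ht.
  have ta1 := tangent_cubeB a1 c1; rewrite addrC addKr in ta1.
  have ta2 := tangent_cubeB a2 c2; rewrite addrC addKr in ta2.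
  rewrite -tw coordinate_axis// -tw' coordinate_axis ?tt'//.
move=> ba ba' cah cak he E.
have := coordinate_ge0 a h w; rewrite le_eqVlt => /predU1P[h0|hpos]; last exact: step.
have := coordinate_ge0 a' k w; rewrite le_eqVlt => /predU1P[k0|kpos].
  by rewrite -h0 -k0.
have ke : enorm k < e by rewrite (base_glue_norm ba ba' cah cak he E).
by rewrite (step _ _ _ _ _ _ ba' ba cak cah ke (esym E) kpos).
Qed.

Section Coordinates.
Variable W : seq X.
Hypothesis uW : uniq W.

(** The map iota, restricted to the directions in the finite list [W]; omitting directions can only
    shorten. *)
Definition coordinates l (a h : 'rV_(dim l)) : 'rV[R]_(size W) :=
  \row_j coordinate a h (tnth (in_tuple W) j).

Lemma coordinatesZ l (a h : 'rV_(dim l)) c : 0 <= c ->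
  coordinates a (c *: h) = c *: coordinates a h.
Proof. by move=> c0; apply/rowP => j; rewrite !mxE coordinateZ. Qed.

Lemma enorm_coordinatesB l (a h k : 'rV_(dim l)) :
  at_base a -> tangent a h -> tangent a k ->
  enorm (coordinates a h - coordinates a k) ^+ 2 =
  \sum_t (ch l (a + s *: axis t) \in W)%:R * (axis_part t h - axis_part t k) ^+ 2.
Proof.
move=> ba th tk; rewrite -sum_fibers//; last first.
  move=> t t' ht ht'.
  have pos t1 : axis_part t1 h - axis_part t1 k != 0 -> tangent a (axis t1) /\
      (0 < axis_part t1 h \/ 0 < axis_part t1 k).
    have := axis_part_ge0 t1 h; rewrite le_eqVlt => /predU1P[<-|h1 _].
      have := axis_part_ge0 t1 k; rewrite le_eqVlt => /predU1P[<-|k1 _].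
        by rewrite subrr eqxx.
      by split; [exact: tangent_axis tk k1|right].
    by split; [exact: tangent_axis th h1|left].
  have [_ [h1|k1]] := pos _ ht; have [tt' _] := pos _ ht'.
    exact: coordinate_inj h1 tt'.
  exact: coordinate_inj k1 tt'.
rewrite enorm_sqr /dotp [RHS]big_tnth; apply: eq_bigr => j _.
rewrite !mxE -expr2; congr (_ ^+ 2); rewrite /coordinate -sumrB.
by apply: eq_bigr => t _; rewrite mulrBr.
Qed.

Lemma coordinates_cell_le l (a h k : 'rV_(dim l)) :
  at_base a -> tangent a h -> tangent a k ->
  enorm (coordinates a h - coordinates a k) <= enorm (h - k).
Proof.
move=> ba th tk; rewrite -ler_sqr ?nnegrE ?enorm_ge0// enorm_coordinatesB//.
apply: le_trans (sum_part_le h k); apply: ler_sum => t _.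
by rewrite ler_piMl ?sqr_ge0//; case: (_ \in _).
Qed.

Lemma coordinates_glue l m (a h : 'rV_(dim l)) (a' k : 'rV_(dim m)) :
  at_base a -> at_base a' -> cube (a + h) -> cube (a' + k) -> enorm h < e ->
  ch l (a + h) = ch m (a' + k) -> coordinates a h = coordinates a' k.
Proof.
by move=> ba ba' ch ck he E; apply/rowP => j; rewrite !mxE; apply: coordinate_glue E.
Qed.

(** Each segment is not lengthened within its cell, and at its ends the coordinates seen from
    neighbouring cells agree. The bound [enorm k + r < e] lets [develop] find the base point in each
    cell crossed. *)
Lemma coordinates_string x y r : cube_string ch x y r ->
  forall n (a' k : 'rV_(dim n)), at_base a' -> cube (a' + k) -> ch n (a' + k) = y ->
    enorm k + r < e ->
  forall m (a h : 'rV_(dim m)), at_base a -> cube (a + h) -> ch m (a + h) = x ->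
  enorm (coordinates a h - coordinates a' k) <= r.
Proof.
elim=> {x y r} [x n a' k ba' cak kx ke m a h ba cah hx|].
  rewrite addr0 in ke; rewrite (coordinates_glue ba' ba cak cah ke) ?subrr ?enorm0//.
  by rewrite kx hx.
move=> l u0 v0 y r cu0 cv0 st IH n a' k ba' cak ky ke m a h ba cah hx.
move: ke; rewrite eucl_distE => ke.
have r0 := cube_string_ge0 st; have uv0 := enorm_ge0 (u0 - v0).
have [ca' a'b] := ba'.
have nk : enorm (a' - (a' + k)) = enorm k by rewrite opprD addrA subrr sub0r enormN.
have [|a0 [ca0 a0a' h1 _]] :=
  develop st e01 cak ky ca' (b_margin ca' a'b) _ cv0 erefl.
  by rewrite nk; lra.
have ba0 : at_base a0 by split; rewrite // a0a'.
have vE : a0 + (v0 - a0) = v0 by rewrite addrC subrK.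
have uE : a0 + (u0 - a0) = u0 by rewrite addrC subrK.
have := IH n a' k ba' cak ky _ l a0 (v0 - a0) ba0; rewrite vE.
move=> /(_ _ cv0 erefl)/wrap[]; first lra.
move=> H.
have H2 := coordinates_cell_le ba0 (tangent_cubeB a0 cu0) (tangent_cubeB a0 cv0).
have uve : (u0 - a0) - (v0 - a0) = u0 - v0 by rewrite opprB addrA subrK.
rewrite uve in H2.
rewrite -(@coordinates_glue l m a0 (u0 - a0) a h) ?uE ?hx//; last first.
  have : enorm (u0 - a0) <= enorm (u0 - v0) + enorm (v0 - a0).
    by apply: le_trans (enormD _ _); rewrite addrA subrK.
  by rewrite (enormB v0); rewrite nk in h1; lra.
set A := coordinates a0 (u0 - a0) in H2 *; set B := coordinates a0 (v0 - a0) in H H2.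
have : enorm (A - coordinates a' k) <= enorm (A - B) + enorm (B - coordinates a' k).
  by apply: le_trans (enormD _ _); rewrite addrA subrK.
lra.
Qed.

Lemma coordinates_lipschitz n m (a' k : 'rV_(dim n)) (a h : 'rV_(dim m)) :
  at_base a' -> cube (a' + k) -> at_base a -> cube (a + h) ->
  enorm k + mdist (ch m (a + h)) (ch n (a' + k)) < e ->
  enorm (coordinates a h - coordinates a' k) <= mdist (ch m (a + h)) (ch n (a' + k)).
Proof.
move=> ba' cak ba cah ke; rewrite leNgt; apply/negP => lt.
have [|r st rd] := @exists_cube_string _ _ K (ch m (a + h)) (ch n (a' + k))
  (Num.min (e - enorm k) (enorm (coordinates a h - coordinates a' k))).
  by rewrite lt_min lt andbT; lra.
move: rd; rewrite lt_min => /andP[r1 r2].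
have := coordinates_string st ba' cak erefl _ ba cah erefl.
by move=> /(_ _)/wrap[]; lra.
Qed.

End Coordinates.

Definition axis_points l (a : 'rV_(dim l)) : seq X :=
  [seq ch l (a + s *: axis t) | t <- enum {: bool * 'I_(dim l)}].

Lemma enorm_coordinates l (a h : 'rV_(dim l)) (W : seq X) : uniq W ->
  {subset axis_points a <= W} -> at_base a -> tangent a h ->
  enorm (coordinates W a h) = enorm h.
Proof.
move=> uW sW ba th.
have t0 : tangent a 0 by move=> i; rewrite mxE.
apply/eqP; rewrite -(eqrXn2 (n := 2)) ?enorm_ge0//; apply/eqP.
have c0 : coordinates W a 0 = 0.
  by rewrite -[in LHS](scale0r 0) coordinatesZ// scale0r.
rewrite -[coordinates W a h]subr0 -c0 enorm_coordinatesB// -[in RHS](subr0 h).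
rewrite -(sum_part_eq (k := 0)); last by move=> i; rewrite mxE mulr0.
apply: eq_bigr => t _; rewrite sW ?mul1r//.
by apply: map_f; rewrite mem_enum.
Qed.

(** The chart bounds the distance from above; the 1-Lipschitz coordinates, isometric for equal
    signs, bound it from below. [local_dist] would not do, as [a + h] may be arbitrarily close to a
    facet. *)
Lemma orthant_isometry l (a h k : 'rV_(dim l)) : at_base a ->
  cube (a + h) -> cube (a + k) -> (forall i, 0 <= h 0 i * k 0 i) ->
  enorm k + enorm (h - k) < e ->
  mdist (ch l (a + h)) (ch l (a + k)) = enorm (h - k).
Proof.
move=> ba cah cak hk he.
have hkE : a + h - (a + k) = h - k by rewrite opprD addrACA subrr add0r.
have le := chart_dist_le cah cak; rewrite hkE in le.
apply/eqP; rewrite eq_le le /=.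
pose W := undup (axis_points a).
have th := tangent_cubeB a cah; rewrite addrC addKr in th.
have tk := tangent_cubeB a cak; rewrite addrC addKr in tk.
have := coordinates_lipschitz (undup_uniq (axis_points a)) ba cak ba cah.
move=> /(_ _)/wrap[]; first lra.
apply: le_trans; rewrite -ler_sqr ?nnegrE ?enorm_ge0//.
rewrite enorm_coordinatesB ?undup_uniq// -sum_part_eq//.
apply: ler_sum => t _; have tW : ch l (a + s *: axis t) \in axis_points a by apply: map_f; rewrite mem_enum.
by rewrite mem_undup tW mul1r.
Qed.

Lemma base_dist l (a h : 'rV_(dim l)) : at_base a -> cube (a + h) ->
  2 * enorm h < e -> mdist b (ch l (a + h)) = enorm h.
Proof.
move=> [ca aE] cah he.
have nE : enorm (a - (a + h)) = enorm h by rewrite opprD addrA subrr sub0r enormN.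
by rewrite -aE (local_dist e01 ca cah (b_margin ca aE)) nE.
Qed.

End LocalCone.

(** * Convexity *)

Section Jensen.
Variables (R : realType) (n : nat).

(** [G] is convex only inside [D], so membership of the partial averages is carried through the
    induction. *)
Lemma jensen_average (D : 'rV[R]_n -> Prop) (G : 'rV[R]_n -> R) :
  (forall p q t, D p -> D q -> 0 <= t <= 1 ->
    D (p + t *: (q - p)) /\ G (p + t *: (q - p)) <= (1 - t) * G p + t * G q) ->
  forall (I : Type) (i0 : I) (r : seq I) (v : I -> 'rV[R]_n), (forall i, D (v i)) ->
  D ((size r).+1%:R^-1 *: \sum_(i <- i0 :: r) v i) /\
  G ((size r).+1%:R^-1 *: \sum_(i <- i0 :: r) v i) <=
    (size r).+1%:R^-1 * \sum_(i <- i0 :: r) G (v i).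
Proof.
move=> conv I i0 r v Dv; elim: r i0 => [|i1 r IH] i0.
  by rewrite !big_seq1 invr1 scale1r mul1r; split.
have [D1 G1] := IH i1; rewrite !(big_cons _ _ i0).
set S := \sum_(i <- i1 :: r) v i in D1 G1 *.
set T := \sum_(i <- i1 :: r) G (v i) in G1 *.
set N : R := (size r).+1%:R in D1 G1 *.
have N0 : 0 < N by rewrite ltr0n.
have NE : (size (i1 :: r)).+1%:R = N + 1 :> R by rewrite /= -natr1.
rewrite NE; have N1 : 0 < N + 1 by lra.
have t01 : 0 <= N / (N + 1) <= 1.
  by rewrite divr_ge0 ?(ltW N0) ?(ltW N1)// ler_pdivrMr// mul1r; lra.
have [] := conv _ _ _ (Dv i0) D1 t01.
have -> : v i0 + (N / (N + 1)) *: (N^-1 *: S - v i0) = (N + 1)^-1 *: (v i0 + S).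
  by apply/rowP => j; rewrite !mxE; field; rewrite !gt_eqF.
move=> D2 G2; split => //; apply: le_trans G2 _.
have -> : (N + 1)^-1 * (G (v i0) + T) =
  (1 - N / (N + 1)) * G (v i0) + N / (N + 1) * (N^-1 * T).
  by field; rewrite !gt_eqF.
by rewrite lerD2l ler_wpM2l//; lra.
Qed.

Lemma enorm_segment_sqr (p q : 'rV[R]_n) t :
  enorm (p + t *: (q - p)) ^+ 2 = (1 - t) * enorm p ^+ 2 + t * enorm q ^+ 2 -
    t * (1 - t) * enorm (p - q) ^+ 2.
Proof.
rewrite !enorm_sqr !dotpBB !(dotpDl, dotpDr, dotpZl, dotpZr, dotpNl, dotpNr).
by rewrite (dotpC q p); ring.
Qed.

(** [u'] and [v'] are the parts outside the common support. Cauchy-Schwarz on the common support is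
    followed by Cauchy-Schwarz in the plane for [(|u - u'|, |u'|)] and [(|v - v'|, |v'|)]. *)
Lemma cauchy_schwarz_disjoint (u v u' v' : 'rV[R]_n) :
  (forall i, 0 <= u 0 i) -> (forall i, 0 <= v 0 i) ->
  (forall i, u' 0 i = if v 0 i == 0 then u 0 i else 0) ->
  (forall i, v' 0 i = if u 0 i == 0 then v 0 i else 0) ->
  dotp u v + enorm u' * enorm v' <= enorm u * enorm v.
Proof.
move=> u0 v0 u'E v'E.
have uv : dotp u v = dotp (u - u') (v - v').
  apply: eq_bigr => i _; rewrite !mxE u'E v'E.
  by case: eqP => [->|_]; case: eqP => [->|_]; ring.
have nu : enorm u ^+ 2 = enorm (u - u') ^+ 2 + enorm u' ^+ 2.
  rewrite !enorm_sqr -big_split; apply: eq_bigr => i _ /=.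
  by rewrite !mxE u'E; case: eqP => _; ring.
have nv : enorm v ^+ 2 = enorm (v - v') ^+ 2 + enorm v' ^+ 2.
  rewrite !enorm_sqr -big_split; apply: eq_bigr => i _ /=.
  by rewrite !mxE v'E; case: eqP => _; ring.
have := dotp_le_enorm (u - u') (v - v'); rewrite -uv => le.
have h1 := enorm_ge0 (u - u'); have h2 := enorm_ge0 (v - v').
have h3 := enorm_ge0 u'; have h4 := enorm_ge0 v'.
apply: (@le_trans _ _ (enorm (u - u') * enorm (v - v') + enorm u' * enorm v')).
  by rewrite lerD2r.
rewrite -ler_sqr ?nnegrE ?addr_ge0 ?mulr_ge0 ?enorm_ge0// [leRHS]exprMn nu nv.
move: (enorm (u - u')) (enorm (v - v')) (enorm u') (enorm v') => x y z w.
rewrite -subr_ge0 (_ : _ - _ = (x * w - y * z) ^+ 2) ?sqr_ge0//; ring.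
Qed.

End Jensen.

Section Restriction.
Variables (R : realType) (n : nat).
Implicit Types (C : pred (bool * 'I_n)) (h : 'rV[R]_n).

Definition axis_restrict C h : 'rV[R]_n := \sum_(t | C t) axis_part t h *: axis t.

Lemma axis_restrictE C h i :
  axis_restrict C h 0 i = (C (true, i))%:R * Num.max 0 (h 0 i) -
    (C (false, i))%:R * Num.max 0 (- h 0 i).
Proof.
rewrite /axis_restrict big_mkcond summxE sum_axes (bigD1 i)//= big1 ?addr0; last first.
  move=> j ji; have E c : (if C (c, j) then axis_part (c, j) h *: axis (c, j) else 0)
      0 i = 0 :> R.
    case: ifP => _; last by rewrite mxE.
    by rewrite mxE axisE eq_sym (negbTE ji) mulr0.
  by rewrite !E addr0.
have E c : (if C (c, i) then axis_part (c, i) h *: axis (c, i) else 0) 0 i =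
    (C (c, i))%:R * axis_part (c, i) h * (if c then 1 else -1) :> R.
  case: ifP => _; last by rewrite mxE !mul0r.
  by rewrite mxE axisE eqxx mul1r.
by rewrite !E axis_partTE axis_partFE mulr1 mulrN1.
Qed.

Lemma axis_restrict_coord C h i : axis_restrict C h 0 i = h 0 i \/ axis_restrict C h 0 i = 0.
Proof.
rewrite axis_restrictE; move: (h 0 i) => x.
by case: (leP 0 x) => hx; case: (leP 0 (- x)) => hx';
  case: (C (true, i)); case: (C (false, i)); rewrite /= ?mul1r ?mul0r; lra.
Qed.

Lemma axis_part_axis_restrict C h t :
  axis_part t (axis_restrict C h) = (C t)%:R * axis_part t h.
Proof.
case: t => c i; rewrite /axis_part !dotp_axis /= axis_restrictE; move: (h 0 i) => x.
have [x0|/ltW x0] := leP 0 x.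
  have nx : - x <= 0 by rewrite oppr_le0.
  rewrite (max_l nx) mulr0 subr0; case: c; rewrite ?mul1r ?mulN1r.
    by rewrite !max_r// mulr_ge0.
  by rewrite (max_l nx) mulr0 max_l// oppr_le0 mulr_ge0.
have nx : 0 <= - x by rewrite oppr_ge0.
rewrite (max_r nx) mulr0 sub0r (mulrN (C (false, i))%:R) opprK; case: c; rewrite ?mul1r ?mulN1r.
  by rewrite (max_l x0) mulr0 max_l// mulr_ge0_le0.
by rewrite (max_r nx) mulrN max_r// oppr_ge0 mulr_ge0_le0.
Qed.

Lemma axis_restrictC C h : h = axis_restrict [predC C] h + axis_restrict C h.
Proof. by rewrite [LHS](sum_part h) (bigID C) addrC. Qed.

Lemma enorm_axis_restrict_le C h : enorm (axis_restrict C h) <= enorm h.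
Proof.
rewrite -ler_sqr ?nnegrE ?enorm_ge0// !enorm_sqr; apply: ler_sum => i _.
by case: (axis_restrict_coord C h i) => ->; rewrite ?mul0r// -expr2 sqr_ge0.
Qed.

Lemma tangent_axis_restrict C a h : tangent a h -> tangent a (axis_restrict C h).
Proof.
move=> th i; have [t0 t1] := th i.
by case: (axis_restrict_coord C h i) => ->; split.
Qed.

Lemma axis_part_le t h : axis_part t h <= enorm h.
Proof.
rewrite /axis_part ge_max enorm_ge0/= (le_trans (dotp_le_enorm _ _))//.
by rewrite -[X in _ * enorm X]scale1r enorm_axis// mulr1.
Qed.

End Restriction.

(** * Convexity on an orthant of the tangent cone *)

Section ConeBound.
Variables (R : realType) (X : metricType R) (K : cube_complex X).
Hypothesis cat0X : CAT0 X.
Local Notation ch := (chart X K).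
Local Notation dim := (cdim X K).
Variables (b : X) (e : R).
Hypothesis e01 : 0 < e <= 2^-1.
Hypothesis b_margin : forall l (a : 'rV_(dim l)), cube a -> ch l a = b -> margin e a.
Local Notation base := (at_base b).
Local Notation coord := (coordinate e).

Let e0 : 0 < e. Proof. by case/andP: e01. Qed.

(** One more than the number of axes: the average in [cone_split] also has a zero term, as
    [jensen_average] requires a first element. *)
Definition num_axes (l : cell X K) : R := #|{: bool * 'I_(dim l)}|.+1%:R.

Lemma num_axes_ge1 l : 1 <= num_axes l.
Proof. by rewrite /num_axes ler1n. Qed.

Lemma sign_dist l (a h k : 'rV_(dim l)) : base a -> cube (a + h) -> cube (a + k) ->
  (forall i, 0 <= h 0 i * k 0 i) -> enorm h <= e / 4 -> enorm k <= e / 4 ->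
  mdist (ch l (a + h)) (ch l (a + k)) = enorm (h - k).
Proof.
move=> ba cah cak hk he ke; apply: (orthant_isometry cat0X e01 b_margin) => //.
by have := e0; have := enormD h (- k); rewrite enormN; lra.
Qed.

(* Jensen's inequality for the convex function d(y, .)^2 - |.|^2 on an orthant
   of the tangent cone, where h is written as an average of twice its part
   outside C and of multiples of axis vectors. *)
Lemma cone_split l (a h : 'rV_(dim l)) (C : pred (bool * 'I_(dim l)))
    (kappa : bool * 'I_(dim l) -> R) (y : X) :
  base a -> tangent a h -> 2 * num_axes l * enorm h <= e / 4 ->
  (forall t, C t -> 0 < axis_part t h ->
    let c := 2 * num_axes l * axis_part t h in
    mdist y (ch l (a + c *: axis t)) ^+ 2 = mdist y b ^+ 2 + c ^+ 2 - 2 * c * kappa t) ->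
  mdist y (ch l (a + h)) ^+ 2 - enorm h ^+ 2 - mdist y b ^+ 2 <=
    2^-1 * (mdist y (ch l (a + 2 *: axis_restrict [predC C] h)) ^+ 2 -
      enorm (2 *: axis_restrict [predC C] h) ^+ 2 - mdist y b ^+ 2) -
    2 * \sum_(t | C t) axis_part t h * kappa t.
Proof.
move=> ba th he hC; have [ca aE] := ba; have /andP[e_gt0 e_le] := e01.
set N := num_axes l in he hC *; have N1 : 1 <= N := num_axes_ge1 l.
(* Small vectors with signs compatible with [h], and zero where [h] is: there the chart is isometric
   by [sign_dist]. *)
pose D (p : 'rV_(dim l)) := [/\ cube (a + p),
  forall i, 0 <= p 0 i * h 0 i /\ (h 0 i = 0 -> p 0 i = 0) & enorm p <= e / 4].
pose G (p : 'rV_(dim l)) := mdist y (ch l (a + p)) ^+ 2 - enorm p ^+ 2 - mdist y b ^+ 2.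
have conv p q t : D p -> D q -> 0 <= t <= 1 ->
    D (p + t *: (q - p)) /\ G (p + t *: (q - p)) <= (1 - t) * G p + t * G q.
  move=> [cp sp np] [cq sq nq] t01.
  have segE : a + (p + t *: (q - p)) = (a + p) + t *: ((a + q) - (a + p)).
    by apply/rowP => i; rewrite !mxE; ring.
  have cm : cube (a + (p + t *: (q - p))) by rewrite segE; apply: cube_segment.
  split.
    split => // [i|].
      have [p0 p0'] := sp i; have [q0 q0'] := sq i; rewrite !mxE; split.
        move: p0 q0; move: (p 0 i) (q 0 i) (h 0 i) => x z w xw zw.
        rewrite (_ : _ * w = (1 - t) * (x * w) + t * (z * w)); last by ring.
        by rewrite addr_ge0// mulr_ge0//; lra.
      by move=> h0; rewrite p0'// q0'//; ring.
    have -> : p + t *: (q - p) = (1 - t) *: p + t *: q.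
      by apply/rowP => i; rewrite !mxE; ring.
    apply: le_trans (enormD _ _) _; rewrite !enormZ !ger0_norm; [|lra|lra].
    by have := enorm_ge0 p; have := enorm_ge0 q; nra.
  have pq : mdist (ch l (a + p)) (ch l (a + q)) = enorm (p - q).
    apply: sign_dist => // i; have [p0 p0'] := sp i; have [q0 q0'] := sq i.
    have [h0|h0] := eqVneq (h 0 i) 0; first by rewrite p0'// mul0r.
    have h2 : 0 < h 0 i ^+ 2 by rewrite exprn_even_gt0.
    have : 0 <= (p 0 i * h 0 i) * (q 0 i * h 0 i) by exact: mulr_ge0.
    by rewrite mulrACA -expr2 pmulr_lge0.
  have hm1 : mdist (ch l (a + p)) (ch l (a + (p + t *: (q - p)))) <=
      t * mdist (ch l (a + p)) (ch l (a + q)).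
    apply: le_trans (chart_dist_le cp cm) _; rewrite pq.
    have -> : a + p - (a + (p + t *: (q - p))) = t *: (p - q).
      by apply/rowP => i; rewrite !mxE; ring.
    by rewrite enormZ ger0_norm//; lra.
  have hm2 : mdist (ch l (a + (p + t *: (q - p)))) (ch l (a + q)) <=
      (1 - t) * mdist (ch l (a + p)) (ch l (a + q)).
    apply: le_trans (chart_dist_le cm cq) _; rewrite pq.
    have -> : a + (p + t *: (q - p)) - (a + q) = (1 - t) *: (p - q).
      by apply/rowP => i; rewrite !mxE; ring.
    by rewrite enormZ ger0_norm//; lra.
  (* Subtracting the flat identity [enorm_segment_sqr] removes the quadratic term of the CN
     inequality and leaves convexity. *)
  have := CN_inequality cat0X y t01 hm1 hm2; rewrite pq /G enorm_segment_sqr; lra.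
have cubeD p : tangent a p -> enorm p <= e / 4 -> cube (a + p).
  move=> tp np; have e1 : e <= 2^-1 by case/andP: e01.
  apply: (cube_tangent ca (b_margin ca aE) e1 tp) => i.
  by have := ler_coord_enorm p i; lra.
have hn0 := enorm_ge0 h.
have h2 : 2 * enorm h <= e / 4.
  by apply: le_trans he; rewrite ler_wpM2r// ler_peMr.
have D0 : D 0.
  have n0 : enorm (0 : 'rV[R]_(dim l)) <= e / 4 by rewrite enorm0; lra.
  split => // [|i]; last by rewrite mxE mul0r.
  by apply: cubeD => // i; rewrite mxE.
have tr := tangent_axis_restrict [predC C] th.
have Dr : D (2 *: axis_restrict [predC C] h).
  have n : enorm (2 *: axis_restrict [predC C] h) <= e / 4.
    by rewrite enormZ ger0_norm//; have := enorm_axis_restrict_le [predC C] h; lra.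
  split => // [|i]; first by apply: cubeD => //; apply: tangentZ.
  rewrite mxE; case: (axis_restrict_coord [predC C] h i) => ->.
    by split => [|->]; rewrite ?mulr0// -mulrA mulr_ge0// -expr2 sqr_ge0.
  by rewrite mulr0 mul0r.
(* The factor [N] compensates the weight [N^-1] of the average; the factor 2 compensates the final
   halving with the part outside [C]. *)
pose v (o : option (bool * 'I_(dim l))) : 'rV[R]_(dim l) :=
  if o is Some t then if C t then (2 * N * axis_part t h) *: axis t else 0 else 0.
have Dv o : D (v o).
  case: o => [t|]//=; case: ifP => // Ct.
  have := axis_part_ge0 t h; rewrite le_eqVlt => /predU1P[<-|ht].
    by rewrite mulr0 scale0r.
  have c0 : 0 <= 2 * N * axis_part t h by rewrite !mulr_ge0 ?axis_part_ge0//; lra.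
  have n : enorm ((2 * N * axis_part t h) *: axis t) <= e / 4.
    rewrite enorm_axis//; apply: le_trans he; rewrite ler_wpM2l ?axis_part_le//; lra.
  split => // [|i].
    by apply: cubeD => //; apply: tangentZ => //; exact: tangent_axis th ht.
  rewrite mxE axisE; case: eqP => [->|_]; last by rewrite mulr0 mul0r.
  move: ht; rewrite axis_part_gt0 dotp_axis => ht; split.
    by rewrite -mulrA mulr_ge0// ltW.
  by move=> h0; move: ht; rewrite h0 mulr0 ltxx.
have G0 : G 0 = 0 by rewrite /G addr0 aE enorm0; ring.
have GC t : C t -> G (v (Some t)) = - (4 * N) * (axis_part t h * kappa t).
  move=> Ct; rewrite /v Ct.
  have := axis_part_ge0 t h; rewrite le_eqVlt => /predU1P[<-|ht].
    by rewrite mulr0 scale0r G0 mul0r mulr0.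
  rewrite /G hC// enorm_axis; last by rewrite !mulr_ge0 ?axis_part_ge0//; lra.
  ring.
pose r := [seq Some t | t <- index_enum {: bool * 'I_(dim l)}].
have [D1 G1] := jensen_average conv None r Dv.
have rE : (size r).+1%:R = N :> R.
  by rewrite size_map /N /num_axes -sum1_card -sum1_size.
rewrite rE !big_cons !big_map in D1 G1.
have vE : N^-1 *: (v None + \sum_t v (Some t)) = 2 *: axis_restrict C h.
  rewrite /= add0r -big_mkcond /axis_restrict !scaler_sumr; apply: eq_bigr => t _.
  by rewrite !scalerA; congr (_ *: _); field; rewrite gt_eqF//; lra.
rewrite vE in D1 G1.
have half : 0 <= (2^-1 : R) <= 1 by lra.
have [_] := conv _ _ _ Dr D1 half.
have -> : 2 *: axis_restrict [predC C] h + 2^-1 *: (2 *: axis_restrict C h -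
    2 *: axis_restrict [predC C] h) = h.
  by rewrite [RHS](axis_restrictC C); apply/rowP => i; rewrite !mxE; field.
have GS : G (v None) + \sum_t G (v (Some t)) =
    - (4 * N) * \sum_(t | C t) axis_part t h * kappa t.
  rewrite /= G0 add0r (bigID C) /= [X in _ + X]big1 ?addr0; last first.
    by move=> t /negbTE Ct; rewrite Ct G0.
  by rewrite mulr_sumr; apply: eq_bigr => t /GC.
rewrite GS in G1; set S := \sum_(t | C t) _ in G1 *.
have N0 : N != 0 by rewrite gt_eqF//; lra.
rewrite (_ : N^-1 * _ = - 4 * S) in G1; last by field.
by rewrite /G in G1 *; lra.
Qed.

End ConeBound.

(** * The cone inequality *)

Section ConeComparison.
Variables (R : realType) (X : metricType R) (K : cube_complex X).
Hypothesis cat0X : CAT0 X.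
Local Notation ch := (chart X K).
Local Notation dim := (cdim X K).
Variables (b : X) (e : R).
Hypothesis e01 : 0 < e <= 2^-1.
Hypothesis b_margin : forall l (a : 'rV_(dim l)), cube a -> ch l a = b -> margin e a.
Local Notation base := (at_base b).
Local Notation coord := (coordinate e).

Let e0 : 0 < e. Proof. by case/andP: e01. Qed.

Lemma axis_common l m (a : 'rV_(dim l)) (a' : 'rV_(dim m)) t t' c :
  base a -> base a' -> tangent a (axis t) -> tangent a' (axis t') ->
  ch l (a + (e / 2) *: axis t) = ch m (a' + (e / 2) *: axis t') ->
  0 <= c <= e / 2 -> ch l (a + c *: axis t) = ch m (a' + c *: axis t').
Proof.
move=> ba ba' ta ta' E c0; have /andP[e_gt0 e_le] := e01.
have s0 : 0 <= e / 2 by lra.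
have sle : 0 <= e / 2 <= e by lra.
have ca := cube_axis e01 b_margin ba ta sle.
have ca' := cube_axis e01 b_margin ba' ta' sle.
have ns : enorm ((e / 2) *: axis t) < e by rewrite enorm_axis//; lra.
have [f [f_im f_iso f_ch fh [fa fa']]] := base_glue cat0X b_margin ba ba' ca ca' ns E.
pose q := c / (e / 2); have qs : q * (e / 2) = c by rewrite /q; field; rewrite gt_eqF.
have q01 : 0 <= q <= 1.
  by rewrite /q divr_ge0 ?ler_pdivrMr ?mul1r//; lra.
have pE k (d : 'rV[R]_k) (x : 'rV[R]_k) :
    d + c *: x = d + q *: ((d + (e / 2) *: x) - d).
  by rewrite [_ + _ *: x - d]addrC addKr scalerA qs.
have fin := supp_face_segment fa (supp_face_refl ca) q01.
rewrite pE -(f_ch _ fin) (face_isometry_affine f_iso fa (supp_face_refl ca) fa fin).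
by rewrite fh fa' -pE.
Qed.

Lemma axis_sign n (h : 'rV[R]_n) t c i : 0 < axis_part t h -> 0 <= c ->
  0 <= h 0 i * (c *: axis t) 0 i.
Proof.
rewrite axis_part_gt0 dotp_axis mxE axisE => ht c0.
case: eqP => [->|_]; last by rewrite !mulr0.
by rewrite mulrCA mulr_ge0// mulrC ltW.
Qed.

Lemma base_distC l (a h : 'rV_(dim l)) : base a -> cube (a + h) ->
  enorm h <= e / 4 -> mdist (ch l (a + h)) b = enorm h.
Proof.
move=> ba cah he; rewrite (metric_sym _ b) (base_dist e01 b_margin ba cah)//.
by have /andP[e_gt0 e_le] := e01; lra.
Qed.

(** A common axis can be seen in the cell of [k], in an orthant with [k], where the law of cosines
    is exact. *)
Lemma common_axis_dist l m (a h : 'rV_(dim l)) (a' k : 'rV_(dim m)) t c :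
  base a -> base a' -> tangent a h -> tangent a' k -> cube (a' + k) ->
  enorm k <= e / 4 -> 0 < axis_part t h ->
  0 < coord a' k (ch l (a + (e / 2) *: axis t)) -> 0 <= c <= e / 4 ->
  mdist (ch m (a' + k)) (ch l (a + c *: axis t)) ^+ 2 =
    enorm k ^+ 2 + c ^+ 2 - 2 * c * coord a' k (ch l (a + (e / 2) *: axis t)).
Proof.
move=> ba ba' ta ta' cak ke ht /coordinate_gt0[t' kt' E] c0.
have /andP[e_gt0 e_le] := e01; have c00 : 0 <= c by lra.
have tat := tangent_axis ta ht; have tat' := tangent_axis ta' kt'.
rewrite (axis_common ba ba' tat tat' (esym E)); last by lra.
rewrite (sign_dist cat0X e01 b_margin ba')//; first last.
- by rewrite enorm_axis//; lra.
- by move=> i; exact: axis_sign.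
- by apply: (cube_axis e01 b_margin ba' tat'); lra.
rewrite -E (coordinate_axis cat0X e01 b_margin ba' ta' kt') axis_partE//.
rewrite !enorm_sqr dotpBB !(dotpZr c) !(dotpZl c) dotp_axis_axis; ring.
Qed.

Lemma coordinate_axis_restrict l (a h : 'rV_(dim l)) (P : pred X) w :
  coord a (axis_restrict [pred t | P (ch l (a + (e / 2) *: axis t))] h) w =
  (P w)%:R * coord a h w.
Proof.
rewrite /coordinate mulr_sumr; apply: eq_bigr => t _.
rewrite axis_part_axis_restrict /=.
by case: eqP => [->|_]; rewrite ?mul1r// !mul0r mulr0.
Qed.

Lemma dotp_coordinates l m (a h : 'rV_(dim l)) (a' k : 'rV_(dim m)) W :
  uniq W -> {subset axis_points e a <= W} ->
  dotp (coordinates e W a h) (coordinates e W a' k) =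
  \sum_t axis_part t h * coord a' k (ch l (a + (e / 2) *: axis t)).
Proof.
move=> uW sW; rewrite /dotp.
rewrite (eq_bigr (fun j => coord a h (tnth (in_tuple W) j) *
  coord a' k (tnth (in_tuple W) j))); last by move=> j _; rewrite !mxE.
rewrite -(big_tnth _ _ _ xpredT (fun w => coord a h w * coord a' k w)).
under eq_bigr => w _ do rewrite {1}/coordinate mulr_suml.
rewrite exchange_big; apply: eq_bigr => t _ /=.
have tW : ch l (a + (e / 2) *: axis t) \in W.
  by apply: sW; apply: map_f; rewrite mem_enum.
rewrite (bigD1_seq _ tW uW) /= eqxx mul1r big1 ?addr0// => w /negbTE.
by rewrite eq_sym => ->; rewrite !mul0r.
Qed.

(** Let [h'] and [k'] be the parts along directions not shared, and S the inner product of the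
    coordinates. [cone_split] is applied to [h] against the point of [k], then to [k] against the
    point of [2 *: h']; the remaining pair [2 *: h'], [2 *: k'] is bounded through [b]. This gives
    [d^2 <= |h|^2 + |k|^2 + 2 |h'| |k'| - 2 S], and [cauchy_schwarz_disjoint] replaces [|h'| |k'|]
    by [|h| |k| - S]. *)
Lemma cone_bound l m (a h : 'rV_(dim l)) (a' k : 'rV_(dim m)) W :
  uniq W -> {subset axis_points e a <= W} -> {subset axis_points e a' <= W} ->
  base a -> base a' -> tangent a h -> tangent a' k ->
  2 * num_axes l * enorm h <= e / 4 -> 2 * num_axes m * enorm k <= e / 4 ->
  mdist (ch l (a + h)) (ch m (a' + k)) ^+ 2 <= (enorm h + enorm k) ^+ 2 -
    4 * dotp (coordinates e W a h) (coordinates e W a' k).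
Proof.
move=> uW sW sW' ba ba' ta ta' he ke; have /andP[e_gt0 e_le] := e01.
have norm_le n (N : R) (p : 'rV[R]_n) : 1 <= N -> 2 * N * enorm p <= e / 4 ->
    2 * enorm p <= e / 4.
  by move=> N1; apply: le_trans; rewrite ler_wpM2r ?enorm_ge0// ler_peMr.
have he2 := norm_le _ _ _ (num_axes_ge1 l) he.
have ke2 := norm_le _ _ _ (num_axes_ge1 m) ke.
have hn := enorm_ge0 h; have kn := enorm_ge0 k.
have cubeD n (c p : 'rV_(dim n)) : base c -> tangent c p -> enorm p <= e / 4 ->
    cube (c + p).
  move=> [cc cE] tp np; apply: (cube_tangent cc (b_margin cc cE) e_le tp) => i.
  by have := ler_coord_enorm p i; lra.
have cak : cube (a' + k) by apply: cubeD => //; lra.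
pose C := [pred t | 0 < coord a' k (ch l (a + (e / 2) *: axis t))].
pose C' := [pred t | 0 < coord a h (ch m (a' + (e / 2) *: axis t))].
pose h' := axis_restrict [predC C] h; pose k' := axis_restrict [predC C'] k.
have h'_le : enorm h' <= enorm h := enorm_axis_restrict_le _ _.
have k'_le : enorm k' <= enorm k := enorm_axis_restrict_le _ _.
have nn n (p : 'rV[R]_n) : enorm (2 *: p) = 2 * enorm p.
  by rewrite enormZ ger0_norm.
have th' : tangent a (2 *: h') by apply: tangentZ => //; exact: tangent_axis_restrict.
have tk' : tangent a' (2 *: k') by apply: tangentZ => //; exact: tangent_axis_restrict.
have cah' : cube (a + 2 *: h') by apply: cubeD => //; rewrite nn; lra.
have cak' : cube (a' + 2 *: k') by apply: cubeD => //; rewrite nn; lra.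
have small n (N : R) (p : 'rV[R]_n) t : 1 <= N -> 2 * N * enorm p <= e / 4 ->
    0 <= 2 * N * axis_part t p <= e / 4.
  move=> N1 le; rewrite !mulr_ge0 ?axis_part_ge0//=; last lra.
  by apply: le_trans le; rewrite ler_wpM2l ?axis_part_le//; lra.
have yb : mdist (ch m (a' + k)) b = enorm k by apply: base_distC => //; lra.
have y2b : mdist (ch l (a + 2 *: h')) b = 2 * enorm h'.
  by rewrite -nn; apply: base_distC => //; rewrite nn; lra.
have y2b' : mdist (ch m (a' + 2 *: k')) b = 2 * enorm k'.
  by rewrite -nn; apply: base_distC => //; rewrite nn; lra.
have := cone_split cat0X e01 b_margin (C := C) (y := ch m (a' + k))
  (kappa := fun t => coord a' k (ch l (a + (e / 2) *: axis t))) ba ta he.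
move=> /(_ _)/wrap[].
  move=> t Ct ht /=; rewrite yb (common_axis_dist ba ba' ta ta')//; first lra.
  exact: small (num_axes_ge1 l) he.
rewrite yb -/h' => R1.
(* [h'] is orthogonal to the shared axes, so [kappa] vanishes here. *)
have := cone_split cat0X e01 b_margin (C := C') (kappa := fun=> 0)
  (y := ch l (a + 2 *: h')) ba' ta' ke.
move=> /(_ _)/wrap[].
  move=> t' Ct' kt' /=; rewrite y2b mulr0 subr0.
  have [t ht tt'] := coordinate_gt0 Ct'.
  have tat := tangent_axis ta ht; have tat' := tangent_axis ta' kt'.
  have c0 := small _ _ _ t' (num_axes_ge1 m) ke.
  set c := 2 * num_axes m * _ in c0 *; have c00 : 0 <= c by lra.
  have Ct : C t.
    by rewrite /C /= tt' (coordinate_axis cat0X e01 b_margin ba' ta' kt').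
  rewrite -(axis_common ba ba' tat tat' tt'); last lra.
  have sgn i : 0 <= h' 0 i * (axis t) 0 i.
    have := axis_sign i ht ler01; rewrite scale1r => sg.
    by case: (axis_restrict_coord [predC C] h i) => -> //; rewrite mul0r.
  have d0 : dotp h' (axis t) = 0.
    apply/eqP; rewrite eq_le; apply/andP; split; last exact: sumr_ge0.
    have := axis_part_axis_restrict [predC C] h t; rewrite -/h'.
    have -> : [predC C] t = false by apply/negbTE; rewrite /= negbK.
    rewrite mul0r.
    by move=> <-; rewrite /axis_part le_max lexx orbT.
  rewrite (sign_dist cat0X e01 b_margin ba)//; first last.
  - by rewrite enorm_axis//; lra.
  - by rewrite nn; lra.
  - by move=> i; rewrite mxE [X in _ * X]mxE mulrACA mulr_ge0// mulr_ge0.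
  - by apply: (cube_axis e01 b_margin ba tat); lra.
  rewrite -nn !enorm_sqr dotpBB !(dotpZr c) !(dotpZl c) (dotpZl 2 h' (axis t)).
  by rewrite d0 dotp_axis_axis; ring.
rewrite y2b -/k' big1 => [|t _]; last by rewrite mulr0.
move=> R2.
have R3 : mdist (ch l (a + 2 *: h')) (ch m (a' + 2 *: k')) <= 2 * enorm h' + 2 * enorm k'.
  by rewrite -y2b -y2b' (metric_sym (ch m (a' + 2 *: k'))) metric_triangle.
have {}R3 : mdist (ch l (a + 2 *: h')) (ch m (a' + 2 *: k')) ^+ 2 <=
    (2 * enorm h' + 2 * enorm k') ^+ 2.
  by rewrite ler_sqr ?nnegrE ?mdist_ge0// addr_ge0 ?mulr_ge0 ?enorm_ge0.
rewrite !nn in R1 R2.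
rewrite (metric_sym (ch l (a + 2 *: h')) (ch m (a' + k))) in R2.
rewrite (metric_sym (ch m (a' + k)) (ch l (a + h))) in R1.
have dE : \sum_(t | C t) axis_part t h * coord a' k (ch l (a + (e / 2) *: axis t)) =
    dotp (coordinates e W a h) (coordinates e W a' k).
  rewrite (dotp_coordinates _ _ _ uW sW) [RHS](bigID C) /= [X in _ + X]big1 ?addr0//.
  move=> t; rewrite -leNgt => le0.
  by rewrite (_ : coord _ _ _ = 0) ?mulr0//; apply/eqP; rewrite eq_le le0 coordinate_ge0.
rewrite dE in R1.
have := @cauchy_schwarz_disjoint _ _ (coordinates e W a h) (coordinates e W a' k)
  (coordinates e W a h') (coordinates e W a' k').
move=> /(_ _ _ _ _)/wrap[].
- by move=> i; rewrite mxE coordinate_ge0.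
- by move=> i; rewrite mxE coordinate_ge0.
- move=> i; rewrite !mxE.
  rewrite (coordinate_axis_restrict a h [pred w | ~~ (0 < coord a' k w)]) /=.
  rewrite lt_neqAle coordinate_ge0 andbT negbK eq_sym.
  by case: eqP; rewrite ?mul1r ?mul0r.
- move=> i; rewrite !mxE.
  rewrite (coordinate_axis_restrict a' k [pred w | ~~ (0 < coord a h w)]) /=.
  rewrite lt_neqAle coordinate_ge0 andbT negbK eq_sym.
  by case: eqP; rewrite ?mul1r ?mul0r.
rewrite !(enorm_coordinates cat0X e01 b_margin uW)//; try exact: tangent_axis_restrict.
lra.
Qed.

End ConeComparison.

(** * The Izeki-Nayatani invariant *)

Section FiniteSums.
Variable R : realType.

Lemma seq_lower_bound (T : eqType) (s : seq T) (f : T -> R) :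
  (forall x, 0 < f x) -> exists2 m, 0 < m & forall x, x \in s -> m <= f x.
Proof.
move=> f0; elim: s => [|x s [m m0 mP]]; first by exists 1.
exists (Num.min m (f x)); first by rewrite lt_min m0 f0.
move=> y; rewrite inE ge_min => /predU1P[->|/mP->//]; by rewrite lexx orbT.
Qed.

Lemma enorm_sum_sqr (T : Type) (s : seq T) n (c : T -> R) (phi : T -> euclidean R n) :
  `|\sum_(p <- s) c p *: phi p| ^+ 2 =
  \sum_(p <- s) \sum_(q <- s) c p * (c q * dotp (phi p) (phi q)).
Proof.
have dl (v : euclidean R n) (F : T -> euclidean R n) :
    dotp (\sum_(p <- s) F p) v = \sum_(p <- s) dotp (F p) v.
  elim: s => [|p r IH]; first by rewrite !big_nil -(scale0r v) dotpZl mul0r.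
  by rewrite !big_cons dotpDl IH.
rewrite euclidean_normE enorm_sqr dl; apply: eq_bigr => p _.
rewrite dotpC dl; apply: eq_bigr => q _.
by rewrite dotpZl dotpZr dotpC mulrCA.
Qed.

Lemma mean_sqr_le (T : Type) (s : seq T) (c D : T -> R) :
  (forall x, 0 <= c x) -> \sum_(p <- s) c p = 1 ->
  (\sum_(p <- s) c p * D p) ^+ 2 <= \sum_(p <- s) c p * D p ^+ 2.
Proof.
move=> c0 c1; set m := \sum_(p <- s) c p * D p.
have E x : \sum_(p <- s) c p * (D p - x) ^+ 2 = \sum_(p <- s) c p * D p ^+ 2 -
    2 * x * (\sum_(p <- s) c p * D p) + x ^+ 2 * \sum_(p <- s) c p.
  by rewrite !mulr_sumr -sumrB -big_split; apply: eq_bigr => p _ /=; ring.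
have : 0 <= \sum_(p <- s) c p * (D p - m) ^+ 2.
  by apply: sumr_ge0 => p _; rewrite mulr_ge0 ?sqr_ge0.
by rewrite E c1 -/m; lra.
Qed.

End FiniteSums.

Section IzekiNayatani.
Variables (R : realType) (X : metricType R) (K : cube_complex X).
Hypothesis cat0X : CAT0 X.
Local Notation ch := (chart X K).
Local Notation dim := (cdim X K).

Lemma uniform_margin (b : X) : exists2 e, 0 < e <= 2^-1 &
  forall l (a : 'rV_(dim l)), cube a -> ch l a = b -> margin e a.
Proof.
have [l0 [a0 ca0 a0b]] := chart_surj X K b.
have [e e01 me] := exists_margin ca0; exists e => // l a ca ab.
by apply: (glue_margin ca0 ca _ e01 me); rewrite a0b ab.
Qed.

(** A base point and a velocity in one cell. Time is normalized as on the whole geodesic to [p],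
    although [germ_point] follows it only for small parameters. *)
Definition germ := {l : cell X K & ('rV[R]_(dim l) * 'rV[R]_(dim l))%type}.

Definition germ_point (G : germ) (t : R) : X :=
  ch (tag G) ((tagged G).1 + t *: (tagged G).2).

(** A cell containing a point [x] of the geodesic close to [b] also contains [b], at the same
    distance. The segment joining them in that cell realizes [d(b, x)], so it is the geodesic by
    uniqueness. *)
Lemma geodesic_germ b p c e : 0 < e <= 2^-1 ->
  (forall l (a : 'rV_(dim l)), cube a -> ch l a = b -> margin e a) ->
  geodesic b p c ->
  exists G : germ, [/\ at_base b (tagged G).1, tangent (tagged G).1 (tagged G).2,
    enorm (tagged G).2 = mdist b p & exists2 t0, 0 < t0 <= 1 &
      forall t, 0 <= t <= t0 -> cube ((tagged G).1 + t *: (tagged G).2) /\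
        c (t * mdist b p) = germ_point G t].
Proof.
move=> e01 b_margin gc; have /andP[e_gt0 e_le] := e01.
have [c0 c1 cd] := gc; have D0 := mdist_ge0 b p; set D := mdist b p in c1 cd D0 *.
(* Keeps [t0 * D] below [e / 4]; [D + 1] avoids a division by 0 and gives [t0 <= 1]. *)
pose t0 := e / (4 * (D + 1)).
have t0D : t0 * (4 * (D + 1)) = e by rewrite /t0; field; rewrite gt_eqF//; lra.
have t0_gt0 : 0 < t0 by rewrite divr_gt0// mulr_gt0//; lra.
have t0_le1 : t0 <= 1 by rewrite ler_pdivrMr ?mulr_gt0//; lra.
have on_c s t : 0 <= s <= 1 -> 0 <= t <= 1 -> mdist (c (s * D)) (c (t * D)) = `|s - t| * D.
  move=> hs ht; rewrite cd; [|nra|nra].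
  by rewrite -mulrBl normrM (ger0_norm D0).
set x := c (t0 * D).
have bx : mdist b x = t0 * D.
  by rewrite /x -c0 -{1}(mul0r D) on_c; [rewrite sub0r normrN gtr0_norm|lra|lra].
have [l0 [a0 ca0 a0b]] := chart_surj X K b.
have [l [w cw wx]] := chart_surj X K x.
have [|a [ca ab ma aw]] := near_preimage e01 ca0 (b_margin _ _ ca0 a0b) _ cw wx.
  by rewrite a0b bx; nra.
rewrite a0b in ab aw.
have nwa : enorm (w - a) = t0 * D by rewrite enormB aw bx.
pose g := t0^-1 *: (w - a).
have gn : enorm g = D.
  by rewrite enormZ nwa ger0_norm ?invr_ge0 ?(ltW t0_gt0)// mulKf// gt_eqF.
exists (existT _ l (a, g)); split => //=; first by apply: tangentZ;
  [rewrite invr_ge0 ltW|exact: tangent_cubeB].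
exists t0 => [|t ht]; first by rewrite t0_gt0.
have q01 : 0 <= t / t0 <= 1.
  by rewrite divr_ge0 ?(ltW t0_gt0) ?ler_pdivrMr ?mul1r//; lra.
have qt : t / t0 * t0 = t by rewrite divfK// gt_eqF.
have qE : (1 - t / t0) * (t0 * D) = (t0 - t) * D.
  by rewrite mulrA mulrBl mul1r qt.
have segE : a + t *: g = a + (t / t0) *: (w - a) by rewrite /g scalerA.
have cm : cube (a + t *: g) by rewrite segE; apply: cube_segment.
split => //; rewrite /germ_point /=.
apply: (between_unique cat0X (x := b) (y := x) q01); rewrite bx.
- rewrite -{1}c0 -{1}(mul0r D) on_c; [|lra|lra].
  by rewrite sub0r normrN ger0_norm; [rewrite mulrA qt|lra].
- rewrite /x on_c; [|lra|lra].
  by rewrite distrC ger0_norm ?qE//; lra.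
- rewrite -{1}ab; apply: le_trans (chart_dist_le ca cm) _.
  rewrite opprD addrA subrr sub0r enormN enormZ gn ger0_norm; last lra.
  by rewrite mulrA qt.
- rewrite -{1}wx; apply: le_trans (chart_dist_le cm cw) _.
  have -> : a + t *: g - w = (t - t0) *: g.
    rewrite segE -{2}qt; apply/rowP => i; rewrite !mxE; field.
    by rewrite gt_eqF.
  by rewrite enormZ gn distrC ger0_norm ?qE//; lra.
Qed.

End IzekiNayatani.

(** * The bound for one measure *)

Section DeltaBound.
Variables (R : realType) (X : metricType R) (K : cube_complex X).
Hypothesis cat0X : CAT0 X.
Local Notation ch := (chart X K).
Local Notation dim := (cdim X K).

(* Here x stands for the distance from a point z = germ_point (G p) t to the
   point at parameter r on the geodesic from b to q, and d for d(z, q). *)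
Lemma first_order_bound (r Dp Dq k : R) : 0 < r -> 0 <= Dp -> 0 <= Dq ->
  (Dq = 0 -> k = 0) ->
  exists C, forall t d x, 0 < t <= 1 -> 0 <= x -> 0 <= d -> d <= x + (1 - r) * Dq ->
    r <= 1 -> x ^+ 2 <= (t * Dp + r * Dq) ^+ 2 - 4 * (t * r) * k ->
    d ^+ 2 <= Dq ^+ 2 + 2 * t * (Dp * Dq - 2 * k) + t ^+ 2 * C.
Proof.
move=> r0 Dp0 Dq0 kD; have [DqE|DqN] := eqVneq Dq 0.
  exists (Dp ^+ 2) => t d x t01 x0 d0; rewrite DqE (kD DqE) => dx r1 xx.
  have : d ^+ 2 <= x ^+ 2 by rewrite ler_sqr ?nnegrE//; lra.
  by lra.
have D_gt0 : 0 < Dq by rewrite lt_neqAle eq_sym DqN.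
have rD : 0 < r * Dq by exact: mulr_gt0.
(* Linearization by [2 r Dq x <= x^2 + (r Dq)^2] yields [x <= r Dq + t B + t^2 E]; the coefficient
   [B] of [t] is free of [r]. *)
pose B := (Dp * Dq - 2 * k) / Dq; pose E := Dp ^+ 2 / (2 * (r * Dq)).
have BE : B * Dq = Dp * Dq - 2 * k by rewrite /B; field.
have EE : 2 * (r * Dq) * E = Dp ^+ 2 by rewrite /E; field; rewrite DqN gt_eqF.
have E0 : 0 <= E by rewrite divr_ge0 ?sqr_ge0//; lra.
clearbody B E.
exists (B ^+ 2 + 2 * Dq * E + 2 * `|B| * E + E ^+ 2) => t d x t01 x0 d0 dx r1 xx.
have xle : x <= r * Dq + t * B + t ^+ 2 * E.
  rewrite -(ler_pM2l (_ : 0 < 2 * (r * Dq))); last by lra.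
  rewrite (_ : 2 * (r * Dq) * (r * Dq + t * B + t ^+ 2 * E) =
    2 * (r * Dq) ^+ 2 + 2 * r * t * (B * Dq) + t ^+ 2 * (2 * (r * Dq) * E)); last by ring.
  rewrite BE EE; have := sqr_ge0 (x - r * Dq); nra.
have dle : d <= Dq + t * B + t ^+ 2 * E by lra.
have d2 : d ^+ 2 <= (Dq + t * B + t ^+ 2 * E) ^+ 2.
  by rewrite ler_sqr ?nnegrE//; apply: le_trans dle.
apply: le_trans d2 _; rewrite -BE.
have t_ge0 : 0 <= t by lra.
have t32 : t ^+ 3 <= t ^+ 2 by rewrite exprS ler_piMl ?sqr_ge0//; lra.
have t42 : t ^+ 4 <= t ^+ 2 by rewrite (exprD t 2 2) ler_piMl ?sqr_ge0// expr_le1//; lra.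
have t3 : t ^+ 3 * (B * E) <= t ^+ 2 * (`|B| * E).
  apply: (@le_trans _ _ (t ^+ 3 * (`|B| * E))).
    by rewrite ler_wpM2l ?exprn_ge0// ler_wpM2r// ler_norm.
  by rewrite ler_wpM2r// mulr_ge0.
have t4 : t ^+ 4 * E ^+ 2 <= t ^+ 2 * E ^+ 2.
  by rewrite ler_wpM2r// sqr_ge0.
rewrite (_ : (Dq + t * B + t ^+ 2 * E) ^+ 2 = Dq ^+ 2 + 2 * t * (B * Dq) +
  t ^+ 2 * (B ^+ 2 + 2 * Dq * E) + 2 * (t ^+ 3 * (B * E)) + t ^+ 4 * E ^+ 2); last by ring.
lra.
Qed.

Lemma linear_ge0 (k C t0 : R) : 0 < t0 ->
  (forall t, 0 < t <= t0 -> 0 <= 2 * t * k + t ^+ 2 * C) -> 0 <= k.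
Proof.
move=> t00 h; rewrite leNgt; apply/negP => k0.
pose t := Num.min t0 (- k / (`|C| + 1)).
have C1 : 0 < `|C| + 1 by have := normr_ge0 C; lra.
have t_gt0 : 0 < t by rewrite lt_min t00 divr_gt0// oppr_gt0.
have tt0 : t <= t0 by rewrite ge_min lexx.
have tC : t * (`|C| + 1) <= - k by rewrite -ler_pdivlMr// ge_min lexx orbT.
have := h t; rewrite t_gt0 tt0 => /(_ isT); have := ler_norm C.
move=> hC; rewrite (_ : _ + _ = t * (2 * k + t * C)); last by ring.
rewrite pmulr_rge0// leNgt => /negP; apply.
have : t * C <= t * `|C| by rewrite ler_pM2l.
lra.
Qed.

Variable mu : {fsfun X -> R with 0}.
Hypothesis muP : finsupp_proba mu.
Hypothesis complX : complete_metric X.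

Lemma IN_delta_le_half : (IN_delta mu <= (2^-1 : R)%:E)%E.
Proof.
have [mu0 mu1 _] := muP.
have [b bar_b] := exists_barycenter cat0X muP complX.
have [e e01 b_margin] := uniform_margin K b; have /andP[e_gt0 e_le] := e01.
have /choice[c gc] : forall p, exists c, geodesic b p c by case: cat0X => /(_ b).
have /choice[G GP] := fun p => geodesic_germ cat0X e01 b_margin (gc p).
have /choice[t0 t0P] : forall p, exists t0, 0 < t0 <= 1 /\ forall t, 0 <= t <= t0 ->
    cube ((tagged (G p)).1 + t *: (tagged (G p)).2) /\
    c p (t * mdist b p) = germ_point (G p) t.
  by move=> p; have [_ _ _ [t h1 h2]] := GP p; exists t.
have D0 p : 0 <= mdist b p := mdist_ge0 _ _.
have N1 p := num_axes_ge1 (tag (G p)).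
(* Up to this parameter the geodesic to [p] is straight and short enough for [cone_bound]; the
   support being finite, a common [r > 0] exists. *)
pose f p := Num.min (t0 p) (e / (8 * num_axes (tag (G p)) * (mdist b p + 1))).
have f0 p : 0 < f p.
  have [/andP[h _] _] := t0P p; rewrite lt_min h divr_gt0// !mulr_gt0//.
  by have := D0 p; lra.
have [r r0 rf] := seq_lower_bound (finsupp mu) f0.
have r_t0 p : p \in finsupp mu -> r <= t0 p.
  by move/rf => /le_trans; apply; rewrite ge_min lexx.
have r1 p : p \in finsupp mu -> r <= 1.
  by move/r_t0 => /le_trans; apply; have [/andP[]] := t0P p.
have small p t : p \in finsupp mu -> 0 <= t <= r ->
    2 * num_axes (tag (G p)) * (t * mdist b p) <= e / 4.
  move=> /rf pf tr; have := D0 p; have := N1 p => N D.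
  have Dp1 : 0 < mdist b p + 1 by lra.
  have : r <= e / (8 * num_axes (tag (G p)) * (mdist b p + 1)).
    by apply: le_trans pf _; rewrite ge_min lexx orbT.
  rewrite ler_pdivlMr => [h|]; last by rewrite !mulr_gt0//; lra.
  have : t * (8 * num_axes (tag (G p)) * (mdist b p + 1)) <= e.
    by apply: le_trans h; rewrite ler_wpM2r ?mulr_ge0//; lra.
  have : 0 <= t * num_axes (tag (G p)) by rewrite mulr_ge0//; lra.
  nra.
pose W := undup (flatten [seq axis_points e (tagged (G p)).1 | p <- finsupp mu]).
have uW : uniq W by exact: undup_uniq.
have sW p : p \in finsupp mu -> {subset axis_points e (tagged (G p)).1 <= W}.
  move=> pmu w hw; rewrite mem_undup; apply/flattenP.
  by exists (axis_points e (tagged (G p)).1) => //; apply: map_f.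
pose phi p : euclidean R (size W) := coordinates e W (tagged (G p)).1 (tagged (G p)).2.
have phi_norm p : p \in finsupp mu -> `|phi p| = mdist b p.
  move=> pmu; have [base tan nrm _] := GP p; rewrite euclidean_normE.
  by rewrite (enorm_coordinates cat0X e01 b_margin uW (sW p pmu) base tan).
have cubeG p t : p \in finsupp mu -> 0 <= t <= r ->
    cube ((tagged (G p)).1 + t *: (tagged (G p)).2).
  by move=> pmu tr; have [_ /(_ t)[]] := t0P p; have := r_t0 p pmu; first lra.
have cG p t : p \in finsupp mu -> 0 <= t <= r -> c p (t * mdist b p) = germ_point (G p) t.
  by move=> pmu tr; have [_ /(_ t)[]] := t0P p; have := r_t0 p pmu; first lra.
have nG p t : 0 <= t -> enorm (t *: (tagged (G p)).2) = t * mdist b p.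
  by move=> t_0; have [_ _ nrm _] := GP p; rewrite enormZ ger0_norm// nrm.
have small' p t : p \in finsupp mu -> 0 <= t <= r -> t * mdist b p <= e / 8.
  move=> pmu tr; have := small p t pmu tr; have := N1 p => N1p.
  have tD : 0 <= t * mdist b p by rewrite mulr_ge0//; lra.
  have : t * mdist b p <= num_axes (tag (G p)) * (t * mdist b p) by rewrite ler_peMl.
  lra.
have base p : at_base b (tagged (G p)).1 by have [] := GP p.
have tan p t : 0 <= t -> tangent (tagged (G p)).1 (t *: (tagged (G p)).2).
  by move=> t_0; have [_ h _ _] := GP p; exact: tangentZ.
have bG p t : p \in finsupp mu -> 0 <= t <= r -> mdist b (germ_point (G p) t) = t * mdist b p.
  move=> pmu tr; rewrite /germ_point (base_dist e01 b_margin (base p) (cubeG p t pmu tr)).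
    by rewrite nG//; lra.
  by rewrite nG; [have := small' p t pmu tr; lra|lra].
have rr : 0 <= r <= r by lra.
(* At parameter [r] the coordinates are 1-Lipschitz and distances have contracted by [r];
   homogeneity cancels [r]. *)
have phi_lip p q : p \in finsupp mu -> q \in finsupp mu ->
    `|phi p - phi q| <= mdist p q.
  move=> pmu qmu; have tr0 : 0 <= r by lra.
  have pq : mdist (germ_point (G p) r) (germ_point (G q) r) <= r * mdist p q.
    rewrite -!cG//; apply: (geodesic_contraction cat0X (gc p) (gc q)).
    by have := r1 p pmu; lra.
  have pq' : mdist (germ_point (G p) r) (germ_point (G q) r) <=
      r * mdist b p + r * mdist b q.
    rewrite -!bG// (metric_sym b (germ_point (G p) r)); exact: metric_triangle.
  have := coordinates_lipschitz cat0X e01 b_margin uW (base q) (cubeG q r qmu rr)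
    (base p) (cubeG p r pmu rr).
  move=> /(_ _)/wrap[].
    rewrite nG// -/(germ_point (G p) r) -/(germ_point (G q) r).
    by have := small' p r pmu rr; have := small' q r qmu rr; lra.
  rewrite -/(germ_point (G p) r) -/(germ_point (G q) r) => H.
  rewrite !coordinatesZ// -scalerBr enormZ ger0_norm// in H.
  by rewrite -(ler_pM2l r0) euclidean_normE; apply: le_trans H pq.
have key p q : p \in finsupp mu -> q \in finsupp mu -> exists C, forall t, 0 < t <= r ->
    mdist (germ_point (G p) t) q ^+ 2 <= mdist b q ^+ 2 +
      2 * t * (mdist b p * mdist b q - 2 * dotp (phi p) (phi q)) + t ^+ 2 * C.
  move=> pmu qmu; have [|C CP] := @first_order_bound r (mdist b p) (mdist b q)
    (dotp (phi p) (phi q)) r0 (D0 p) (D0 q).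
    move=> q0; have /eqP := phi_norm q qmu; rewrite q0 euclidean_normE.
    by rewrite (@enorm_eq0 R) => /eqP ->; rewrite dotpC -(scale0r 0) dotpZl mul0r.
  exists C => t tr; have tr' : 0 <= t <= r by case/andP: tr => /ltW ->.
  have [t_ge0 r_ge0] : 0 <= t /\ 0 <= r by case/andP: tr' => -> _; rewrite ltW.
  apply: (CP t _ (mdist (germ_point (G p) t) (germ_point (G q) r))).
  - by have := r1 p pmu; lra.
  - exact: mdist_ge0.
  - exact: mdist_ge0.
  (* The rest of the geodesic to [q], beyond the reach of the cone inequality, has length
     [(1 - r) d(b, q)]. *)
  - apply: le_trans (metric_triangle _ (germ_point (G q) r) _) _; rewrite lerD2l.
    have [_ cq cd] := gc q; rewrite -cG//.
    have -> : mdist (c q (r * mdist b q)) q =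
        mdist (c q (r * mdist b q)) (c q (mdist b q)) by rewrite cq.
    rewrite cd.
    + have := r1 q qmu; have := D0 q => Dq r1q.
      rewrite distrC ger0_norm; first by rewrite mulrBl mul1r.
      by rewrite subr_ge0 ler_piMl.
    + have := r1 q qmu; have := D0 q => Dq r1q.
      by rewrite mulr_ge0 ?(ltW r0)//= ler_piMl.
    + by rewrite D0 lexx.
  - exact: r1 pmu.
  - have [bp tp] := (base p, tan p t); have [bq tq] := (base q, tan q r).
    have := cone_bound cat0X e01 b_margin uW (sW p pmu) (sW q qmu) bp bq
      (tp t_ge0) (tq r_ge0).
    rewrite !nG// => /(_ (small p t pmu tr') (small q r qmu rr)).
    rewrite !coordinatesZ// dotpZl dotpZr => H; apply: le_trans H _.
    by rewrite /phi le_eqVlt; apply/orP; left; apply/eqP; ring.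
have variation p : p \in finsupp mu -> 0 <= \sum_(q <- finsupp mu)
    mu q * (mdist b p * mdist b q - 2 * dotp (phi p) (phi q)).
  move=> pmu.
  have /choice[C CP] : forall q, exists C, q \in finsupp mu -> forall t, 0 < t <= r ->
      mdist (germ_point (G p) t) q ^+ 2 <= mdist b q ^+ 2 +
      2 * t * (mdist b p * mdist b q - 2 * dotp (phi p) (phi q)) + t ^+ 2 * C.
    move=> q; have [qmu|_] := boolP (q \in finsupp mu); last by exists 0.
    by have [C CP] := key p q pmu qmu; exists C.
  apply: (@linear_ge0 _ (\sum_(q <- finsupp mu) mu q * C q) r r0) => t tr.
  (* Minimality is stated away from [b], hence the case [germ_point (G p) t = b]. *)
  have Fb : \sum_(q <- finsupp mu) mu q * mdist b q ^+ 2 <=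
      \sum_(q <- finsupp mu) mu q * mdist (germ_point (G p) t) q ^+ 2.
    have [->//|/eqP/bar_b/ltW//] := eqVneq (germ_point (G p) t) b.
  rewrite -(lerD2l (\sum_(q <- finsupp mu) mu q * mdist b q ^+ 2)) addr0.
  apply: le_trans Fb _; rewrite !mulr_sumr -!big_split /= big_seq [leRHS]big_seq.
  apply: ler_sum => q qmu.
  rewrite (_ : _ + _ = mu q * (mdist b q ^+ 2 + 2 * t * (mdist b p * mdist b q -
    2 * dotp (phi p) (phi q)) + t ^+ 2 * C q)); last by ring.
  by rewrite ler_wpM2l// CP.
apply: ereal_inf_le.
exists (IN_quotient mu phi)%:E; last first.
  rewrite lee_fin /IN_quotient.
  have -> : \sum_(p <- finsupp mu) mu p * `|phi p| ^+ 2 =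
      \sum_(p <- finsupp mu) mu p * mdist b p ^+ 2.
    by rewrite big_seq [RHS]big_seq; apply: eq_bigr => p /phi_norm ->.
  have S0 : 0 <= \sum_(p <- finsupp mu) mu p * mdist b p ^+ 2.
    by apply: sumr_ge0 => p _; rewrite mulr_ge0 ?sqr_ge0.
  (* A vanishing denominator makes the quotient 0, as the inverse of 0 is 0. *)
  have [->|SN] := eqVneq (\sum_(p <- finsupp mu) mu p * mdist b p ^+ 2) 0.
    by rewrite invr0 mulr0 invr_ge0.
  rewrite ler_pdivrMr; last by rewrite lt_neqAle eq_sym SN.
  have := @mean_sqr_le R _ (finsupp mu) mu (mdist b) mu0 mu1.
  have : 0 <= \sum_(p <- finsupp mu) mu p * (\sum_(q <- finsupp mu)
      mu q * (mdist b p * mdist b q - 2 * dotp (phi p) (phi q))).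
    by rewrite big_seq; apply: sumr_ge0 => p /variation h; rewrite mulr_ge0.
  suff -> : \sum_(p <- finsupp mu) mu p * (\sum_(q <- finsupp mu)
      mu q * (mdist b p * mdist b q - 2 * dotp (phi p) (phi q))) =
      (\sum_(p <- finsupp mu) mu p * mdist b p) ^+ 2 -
      2 * `|\sum_(p <- finsupp mu) mu p *: phi p| ^+ 2 by lra.
  rewrite enorm_sum_sqr expr2 !mulr_suml mulr_sumr -sumrB; apply: eq_bigr => p _.
  rewrite !mulr_sumr -sumrB; apply: eq_bigr => q _; ring.
exists b, (euclidean R (size W)), (@edot R (size W)), phi; split => //; split.
- by move=> v; rewrite euclidean_normE enorm_sqr.
- by move=> p /phi_norm ->; rewrite metric_sym.
- exact: phi_lip.
Qed.

End DeltaBound.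

Unset Implicit Arguments.
Local Open Scope ereal_scope.

Theorem theorem1p4 (R : realType) (X : metricType R) (K : cube_complex X) :
  CAT0 X -> complete_metric X -> IN_invariant X <= (2^-1 : R)%:E.
Proof.
move=> cat0X complX; rewrite /IN_invariant; case: asboolP => _; last first.
  by rewrite lee_fin invr_ge0.
by apply: ge_ereal_sup => _ [mu muP <-]; exact: (IN_delta_le_half K cat0X muP complX).
Qed.
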